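(* Over $\mathrm{ZFU}_{\mathrm{R}}$: (1) Tail$^+$ implies (every instance of) RP; (2) Plenitude$^+$ implies Duplication.
   Context: The language of urelement set theory has $\in$ and a unary predicate $\mathcal{A}$ for urelements. $\mathrm{ZFU}_{\mathrm{R}}$ = ZU (urelements have no members, Extensionality for sets, Foundation, Pairing, Union, Powerset, Infinity, Separation scheme) + Replacement scheme; no choice is assumed. For a set $A$ of urelements, a tail of $A$ is a set $B$ of urelements disjoint from $A$ such that every set of urelements disjoint from $A$ injects into $B$. Tail$^+$: every set of urelements has a well-orderable tail. Plenitude$^+$: every set is equinumerous with some set of urelements. Duplication: every set $A$ of urelements has a duplicate, i.e. a set of urelements disjoint from $A$ and equinumerous with it. RP (scheme): for each formula $\varphi$, for every set $x$ there is a transitive set $t\supseteq x$ such that for all $x_1,\dots,x_n\in t$, $\varphi(x_1,\dots,x_n)\leftrightarrow\varphi^t(x_1,\dots,x_n)$. *)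

(* Defs.v *)
(** The first-order language is deeply embedded (for the schemes); theories are
    handled through their models: "over ZFU_R, P implies Q" is rendered as
    "every first-order structure that is a model of ZFU_R and satisfies P
    satisfies Q".  All the notions below quantify only over elements of the
    structure, so that sets, functions, and well-orders are internal ones. *)

Set Implicit Arguments.
Unset Strict Implicit.

(** Variables are de Bruijn indices. *)

Inductive form : Type :=
| Eq (i j : nat)
| Mem (i j : nat)
| Ur (i : nat)
| Neg (p : form)
| And (p q : form)
| Or (p q : form)
| Imp (p q : form)
| All (p : form)
| Ex (p : form).

Fixpoint free (i : nat) (p : form) : Prop :=
  match p with
  | Eq j k | Mem j k => i = j \/ i = k
  | Ur j => i = j
  | Neg p => free i p
  | And p q | Or p q | Imp p q => free i p \/ free i q
  | All p | Ex p => free (S i) p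
  end.

Record structure : Type := Structure {
  carrier :> Type;
  mem : carrier -> carrier -> Prop;
  ur : carrier -> Prop
}.

Definition scons (T : Type) (x : T) (rho : nat -> T) (i : nat) : T :=
  match i with 0 => x | S j => rho j end.

Fixpoint sat (M : structure) (rho : nat -> M) (p : form) : Prop :=
  match p with
  | Eq i j => rho i = rho j
  | Mem i j => mem (rho i) (rho j)
  | Ur i => ur (rho i)
  | Neg p => ~ sat rho p
  | And p q => sat rho p /\ sat rho q
  | Or p q => sat rho p \/ sat rho q
  | Imp p q => sat rho p -> sat rho q
  | All p => forall x : M, sat (scons x rho) p
  | Ex p => exists x : M, sat (scons x rho) p
  end.

(** Truth of the relativization [p^t]: all quantifiers are bounded by [t]. *)
Fixpoint sat_rel (M : structure) (t : M) (rho : nat -> M) (p : form) : Prop :=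
  match p with
  | Eq i j => rho i = rho j
  | Mem i j => mem (rho i) (rho j)
  | Ur i => ur (rho i)
  | Neg p => ~ sat_rel t rho p
  | And p q => sat_rel t rho p /\ sat_rel t rho q
  | Or p q => sat_rel t rho p \/ sat_rel t rho q
  | Imp p q => sat_rel t rho p -> sat_rel t rho q
  | All p => forall x : M, mem x t -> sat_rel t (scons x rho) p
  | Ex p => exists x : M, mem x t /\ sat_rel t (scons x rho) p
  end.

Section SetTheory.

Variable M : structure.

Implicit Types a b f p r s t u v w x y z A B X Y : M.

Local Notation "x ∈ y" := (mem x y) (at level 70, no associativity).

Definition is_set x : Prop := ~ ur x.

Definition subset x y : Prop := forall z, z ∈ x -> z ∈ y.

Definition disjoint x y : Prop := forall z, ~ (z ∈ x /\ z ∈ y).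

Definition transitive_set t : Prop :=
  is_set t /\ forall x y, x ∈ t -> y ∈ x -> y ∈ t.

(** In both schemes, the environment [rho] gives the values of the parameters. *)

Record ZFUR : Prop := {
  zfu_urelements : forall a, ur a -> forall x, ~ x ∈ a;
  zfu_extensionality : forall x y, is_set x -> is_set y ->
    (forall z, z ∈ x <-> z ∈ y) -> x = y;
  zfu_foundation : forall x, (exists y, y ∈ x) ->
    exists y, y ∈ x /\ disjoint y x;
  zfu_pairing : forall x y, exists z, is_set z /\
    forall w, w ∈ z <-> w = x \/ w = y;
  zfu_union : forall x, is_set x -> exists y, is_set y /\
    forall z, z ∈ y <-> exists w, w ∈ x /\ z ∈ w;
  zfu_powerset : forall x, is_set x -> exists y, is_set y /\
    forall z, z ∈ y <-> is_set z /\ subset z x;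
  zfu_infinity : exists s, is_set s /\
    (exists e, e ∈ s /\ is_set e /\ forall z, ~ z ∈ e) /\
    (forall x, x ∈ s ->
       exists y, y ∈ s /\ is_set y /\ forall z, z ∈ y <-> z ∈ x \/ z = x);
  zfu_separation : forall (phi : form) (rho : nat -> M) x, is_set x ->
    exists y, is_set y /\
      forall z, z ∈ y <-> z ∈ x /\ sat (scons z rho) phi;
  zfu_replacement : forall (phi : form) (rho : nat -> M) w, is_set w ->
    (forall x, x ∈ w -> exists! y, sat (scons y (scons x rho)) phi) ->
    exists v, is_set v /\
      forall x, x ∈ w -> exists y, y ∈ v /\ sat (scons y (scons x rho)) phi
}.

(** [p] is the Kuratowski pair [{{a}, {a, b}}]. *)
Definition is_pair p a b : Prop :=
  exists u v,
    (forall z, z ∈ u <-> z = a) /\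
    (forall z, z ∈ v <-> z = a \/ z = b) /\
    (forall z, z ∈ p <-> z = u \/ z = v).

Definition related r a b : Prop := exists p, is_pair p a b /\ p ∈ r.

Definition is_relation r X Y : Prop :=
  is_set r /\
  forall p, p ∈ r -> exists a b, a ∈ X /\ b ∈ Y /\ is_pair p a b.

Definition is_function f X Y : Prop :=
  is_relation f X Y /\ forall a, a ∈ X -> exists! b, related f a b.

Definition is_injection f X Y : Prop :=
  is_function f X Y /\
  forall a a' b, related f a b -> related f a' b -> a = a'.

Definition is_bijection f X Y : Prop :=
  is_injection f X Y /\ forall b, b ∈ Y -> exists a, related f a b.

Definition injects X Y : Prop := exists f, is_injection f X Y.

Definition equinumerous X Y : Prop := exists f, is_bijection f X Y.

Definition strict_well_order r X : Prop :=
  is_relation r X X /\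
  (forall a, ~ related r a a) /\
  (forall a b c, related r a b -> related r b c -> related r a c) /\
  (forall a b, a ∈ X -> b ∈ X -> related r a b \/ a = b \/ related r b a) /\
  (forall Y, subset Y X -> (exists a, a ∈ Y) ->
     exists m, m ∈ Y /\ forall a, a ∈ Y -> ~ related r a m).

Definition well_orderable X : Prop := exists r, strict_well_order r X.

Definition set_of_urelements A : Prop :=
  is_set A /\ forall a, a ∈ A -> ur a.

Definition is_tail B A : Prop :=
  set_of_urelements B /\ disjoint B A /\
  forall C : M, set_of_urelements C -> disjoint C A -> injects C B.

Definition TailPlus : Prop :=
  forall A, set_of_urelements A -> exists B, is_tail B A /\ well_orderable B.

Definition PlenitudePlus : Prop :=
  forall x, is_set x -> exists A, set_of_urelements A /\ equinumerous x A.

Definition is_duplicate B A : Prop :=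
  set_of_urelements B /\ disjoint B A /\ equinumerous B A.

Definition Duplication : Prop :=
  forall A, set_of_urelements A -> exists B, is_duplicate B A.

(** Only the free variables of [phi] are required to take values in [t], so
    that for a sentence the equivalence is not vacuous when [t] is empty. *)
Definition RP (phi : form) : Prop :=
  forall x, is_set x ->
    exists t, transitive_set t /\ subset x t /\
      forall rho : nat -> M, (forall i, free i phi -> rho i ∈ t) ->
        (sat rho phi <-> sat_rel t rho phi).

End SetTheory.

(* Main.v *)
(** Reflection.  Let [A] be a set of urelements such that every set of
    urelements disjoint from [A] has copies outside of any given set of
    urelements: to find [A], compare the sets of urelements with the
    initial segments of a well-orderable tail of the empty set, and take as [A]
    an obstruction for the shortest segment that has one (or the empty set, if
    there is none).  Any larger [A] works as well, so [A] may contain the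
    urelements below the set to be reflected.  Let [B] be a tail of [A].  A copy
    of [B] outside of [A ∪ B] together with [B] injects into [B], which yields
    a decreasing sequence of sets [f1^n(B)] each of which contains a copy of [B]
    disjoint from the next one.  The class of the sets over
    [A ∪ (B \ f1^n(B))], for some [n], is an elementary substructure of the
    universe, by a back-and-forth argument with bijections between sets of
    urelements, extended to the hierarchies over them.  It lies in the
    hierarchy over the set [A ∪ B], which is stratified into sets, so the usual
    proof of the reflection theorem works inside it.

    Duplication.  From a bijection [f] of [A × P(A)] with a set of urelements,
    Cantor's diagonal argument picks in each column [{a} × P(A)] a pair
    which [f] maps outside of [A]. *)

From Stdlib Require Import Classical ClassicalEpsilon Arith Lia.
Require Import Defs.

Set Implicit Arguments.
Unset Strict Implicit.

(** * Definability with parameters *)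

(** The obstacle to the usual reflection argument is that the urelements may form a proper class:
    the witnesses of least rank need not form a set, and Replacement gives no bound when nothing
    singles out one of them. The hierarchy over the set [A ∪ B] has set-sized levels, at the price
    of a proof of elementarity. Its two directions rest on different properties: urelements of the
    universe are placed in [B] by the tail property, and urelements of the substructure are placed
    in the universe, away from those already matched, by the copies. One use of the tail property
    could fill all of [B]; confining it to the part of [f1^n(B)] outside [f1^(n+1)(B)] leaves the
    latter free for the next step. Since the schemes apply only to formulas, every class used has to
    be shown definable, mostly by the tactic [def]. *)

Fixpoint rename (s : nat -> nat) (p : form) : form :=
  let up i := match i with 0 => 0 | S j => S (s j) end in
  match p with
  | Eq i j => Eq (s i) (s j)
  | Mem i j => Mem (s i) (s j)
  | Ur i => Ur (s i)
  | Neg p => Neg (rename s p)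
  | And p q => And (rename s p) (rename s q)
  | Or p q => Or (rename s p) (rename s q)
  | Imp p q => Imp (rename s p) (rename s q)
  | All p => All (rename up p)
  | Ex p => Ex (rename up p)
  end.

(** Covers both [sat] (the class of everything) and [sat_rel] (the class of members of [t]), and
    also truth in proper classes such as [hull]. *)
Fixpoint sat_class (M : structure) (W : M -> Prop) (rho : nat -> M) (p : form)
  : Prop :=
  match p with
  | Eq i j => rho i = rho j
  | Mem i j => mem (rho i) (rho j)
  | Ur i => ur (rho i)
  | Neg p => ~ sat_class W rho p
  | And p q => sat_class W rho p /\ sat_class W rho q
  | Or p q => sat_class W rho p \/ sat_class W rho q
  | Imp p q => sat_class W rho p -> sat_class W rho q
  | All p => forall x : M, W x -> sat_class W (scons x rho) p
  | Ex p => exists x : M, W x /\ sat_class W (scons x rho) p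
  end.

Lemma sat_class_agree (M : structure) (W : M -> Prop) (p : form) :
  forall rho rho' : nat -> M, (forall i, free i p -> rho i = rho' i) ->
  (sat_class W rho p <-> sat_class W rho' p).
Proof.
  induction p as [i j|i j|i|p IH|p IHp q IHq|p IHp q IHq|p IHp q IHq|p IH|p IH];
    intros rho rho' H; simpl in *.
  - rewrite (H i), (H j); tauto.
  - rewrite (H i), (H j); tauto.
  - rewrite (H i); tauto.
  - rewrite (IH rho rho'); firstorder.
  - rewrite (IHp rho rho'), (IHq rho rho'); firstorder.
  - rewrite (IHp rho rho'), (IHq rho rho'); firstorder.
  - rewrite (IHp rho rho'), (IHq rho rho'); firstorder.
  - assert (E : forall x, sat_class W (scons x rho) p <->
                          sat_class W (scons x rho') p)
      by (intro x; apply IH; intros [|i] Hi; simpl; auto).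
    split; intros K x Wx; apply E; auto.
  - assert (E : forall x, sat_class W (scons x rho) p <->
                          sat_class W (scons x rho') p)
      by (intro x; apply IH; intros [|i] Hi; simpl; auto).
    split; intros (x & Wx & K); exists x; split; auto; apply E; auto.
Qed.

Lemma sat_class_mem (M : structure) (t : M) (p : form) :
  forall rho, sat_class (fun x => mem x t) rho p <-> sat_rel t rho p.
Proof.
  induction p as [i j|i j|i|p IH|p IHp q IHq|p IHp q IHq|p IHp q IHq|p IH|p IH];
    intros rho; simpl; try tauto.
  - rewrite IH; tauto.
  - rewrite IHp, IHq; tauto.
  - rewrite IHp, IHq; tauto.
  - rewrite IHp, IHq; tauto.
  - split; intros K x Wx; apply IH; auto.
  - split; intros (x & Wx & K); exists x; split; auto; apply IH; auto.
Qed.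

Lemma sat_class_True (M : structure) (p : form) :
  forall rho : nat -> M, sat_class (fun _ => True) rho p <-> sat rho p.
Proof.
  induction p as [i j|i j|i|p IH|p IHp q IHq|p IHp q IHq|p IHp q IHq|p IH|p IH];
    intros rho; simpl; try tauto.
  - rewrite IH; tauto.
  - rewrite IHp, IHq; tauto.
  - rewrite IHp, IHq; tauto.
  - rewrite IHp, IHq; tauto.
  - split; intros K x; [|intros _]; apply IH; auto.
  - split; [intros (x & _ & K)|intros (x & K)]; exists x; [|split; auto]; apply IH; auto.
Qed.

Lemma sat_ext (M : structure) (p : form) (rho rho' : nat -> M) :
  (forall i, rho i = rho' i) -> (sat rho p <-> sat rho' p).
Proof.
  intro H; rewrite <- !sat_class_True; apply sat_class_agree; auto.
Qed.

Lemma sat_rename (M : structure) (p : form) :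
  forall (s : nat -> nat) (rho : nat -> M),
  sat rho (rename s p) <-> sat (fun i => rho (s i)) p.
Proof.
  induction p as [i j|i j|i|p IH|p IHp q IHq|p IHp q IHq|p IHp q IHq|p IH|p IH];
    intros s rho; simpl; try tauto.
  - rewrite IH; tauto.
  - rewrite IHp, IHq; tauto.
  - rewrite IHp, IHq; tauto.
  - rewrite IHp, IHq; tauto.
  - split; intros K x; specialize (K x); rewrite IH in *;
      (eapply sat_ext; [|exact K]); intros [|i]; reflexivity.
  - split; intros (x & K); exists x; rewrite IH in *;
      (eapply sat_ext; [|exact K]); intros [|i]; reflexivity.
Qed.

Section Definability.

Variable M : structure.

Definition slot (o : nat + M) (e : nat -> M) : M :=
  match o with inl j => e j | inr c => c end.

(** Definability with parameters: [tau] says which free variables of the formula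
    are read from the environment and which ones are parameters. *)
Definition Def (P : (nat -> M) -> Prop) : Prop :=
  exists (phi : form) (tau : nat -> nat + M),
  forall e, P e <-> sat (fun i => slot (tau i) e) phi.

Definition Term (t : (nat -> M) -> M) : Prop := exists o, forall e, t e = slot o e.

Lemma Term_var i : Term (fun e => e i).
Proof. exists (inl i); reflexivity. Qed.

Lemma Term_const c : Term (fun _ => c).
Proof. exists (inr c); reflexivity. Qed.

Lemma Def_iff (P Q : (nat -> M) -> Prop) :
  (forall e, P e <-> Q e) -> Def P -> Def Q.
Proof.
  intros H (phi & tau & E); exists phi, tau; intro e; rewrite <- H; apply E.
Qed.

(** The two formulas may use the same variables with different meanings; moving one to the even and
    the other to the odd indices lets a single [tau] serve both. *)
Lemma Def_binary (op : form -> form -> form) (o : Prop -> Prop -> Prop) P Q :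
  (forall rho p q, sat (M := M) rho (op p q) <-> o (sat rho p) (sat rho q)) ->
  (forall A A' B B', (A <-> A') -> (B <-> B') -> (o A B <-> o A' B')) ->
  Def P -> Def Q -> Def (fun e => o (P e) (Q e)).
Proof.
  intros Hop Ho (phi & tau & HP) (psi & tau' & HQ).
  exists (op (rename (fun i => 2 * i) phi) (rename (fun i => 2 * i + 1) psi)).
  exists (fun i => if Nat.even i then tau (Nat.div2 i) else tau' (Nat.div2 i)).
  intro e; rewrite Hop; apply Ho; [rewrite HP|rewrite HQ]; rewrite sat_rename;
    apply sat_ext; intro i; f_equal.
  - rewrite Nat.even_even, Nat.div2_double; reflexivity.
  - rewrite Nat.even_odd, Nat.add_1_r, Nat.div2_succ_double; reflexivity.
Qed.

Lemma Def_and P Q : Def P -> Def Q -> Def (fun e => P e /\ Q e).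
Proof. apply (Def_binary (op := And)); simpl; tauto. Qed.

Lemma Def_or P Q : Def P -> Def Q -> Def (fun e => P e \/ Q e).
Proof. apply (Def_binary (op := Or)); simpl; tauto. Qed.

Lemma Def_imp P Q : Def P -> Def Q -> Def (fun e => P e -> Q e).
Proof.
  apply (Def_binary (op := Imp) (o := fun A B => A -> B)); simpl; tauto.
Qed.

Lemma Def_not P : Def P -> Def (fun e => ~ P e).
Proof.
  intros (phi & tau & H); exists (Neg phi), tau; intro e; simpl; rewrite H; tauto.
Qed.

Lemma Def_equiv P Q : Def P -> Def Q -> Def (fun e => P e <-> Q e).
Proof. intros; apply Def_and; apply Def_imp; auto. Qed.

(** Even a proposition that no formula expresses is classically equivalent to a trivially true or a
    trivially false formula. *)
Lemma Def_prop (P : Prop) : Def (fun _ => P).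
Proof.
  destruct (classic P) as [H|H].
  - exists (Imp (Ur 0) (Ur 0)), inl; simpl; tauto.
  - exists (Neg (Imp (Ur 0) (Ur 0))), inl; simpl; tauto.
Qed.

Lemma Def_subst P (t : nat -> (nat -> M) -> M) :
  (forall i, Term (t i)) -> Def P -> Def (fun e => P (fun i => t i e)).
Proof.
  intros Ht (phi & tau & H).
  pose (s i := proj1_sig (constructive_indefinite_description _ (Ht i))).
  exists phi, (fun i => match tau i with inl j => s j | inr c => inr c end).
  intro e; rewrite H; apply sat_ext; intro i.
  destruct (tau i) as [j|c]; simpl; [|reflexivity];
  apply (proj2_sig (constructive_indefinite_description _ (Ht j))).
Qed.

Lemma Def_ex (Q : M -> (nat -> M) -> Prop) :
  Def (fun e => Q (e 0) (fun i => e (S i))) -> Def (fun e => exists x, Q x e).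
Proof.
  intros (phi & tau & H).
  (* Index 0 is kept for the bound variable, to which every variable reading [e 0] is sent; all
     others are shifted by one. *)
  exists (Ex (rename (fun i => match tau i with inl 0 => 0 | _ => S i end) phi)).
  exists (fun i => match tau i with inl (S j) => inl j | o => o end).
  intro e; simpl; split; intros (x & K); exists x; [|apply (H (scons x e))];
    rewrite sat_rename in *; [apply (H (scons x e)) in K|];
    (eapply sat_ext; [|exact K]); intro i;
    destruct (tau i) as [[|j]|c] eqn:Hi; unfold scons; rewrite ?Hi; reflexivity.
Qed.

Lemma Def_all (Q : M -> (nat -> M) -> Prop) :
  Def (fun e => Q (e 0) (fun i => e (S i))) -> Def (fun e => forall x, Q x e).
Proof.
  intro H; apply Def_iff with (fun e => ~ exists x, ~ Q x e).
  - intro e; split; [|firstorder].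
    intros K x; apply NNPP; intro N; apply K; exists x; exact N.
  - apply Def_not, (@Def_ex (fun x e => ~ Q x e)), Def_not, H.
Qed.

Lemma Def_mem t u : Term t -> Term u -> Def (fun e => mem (t e) (u e)).
Proof.
  intros (o & Ho) (o' & Ho').
  exists (Mem 0 1), (fun i => match i with 0 => o | _ => o' end).
  intro e; simpl; rewrite Ho, Ho'; tauto.
Qed.

Lemma Def_eq t u : Term t -> Term u -> Def (fun e => t e = u e).
Proof.
  intros (o & Ho) (o' & Ho').
  exists (Eq 0 1), (fun i => match i with 0 => o | _ => o' end).
  intro e; simpl; rewrite Ho, Ho'; tauto.
Qed.

Lemma Def_ur t : Term t -> Def (fun e => ur (t e)).
Proof.
  intros (o & Ho); exists (Ur 0), (fun _ => o); intro e; simpl; rewrite Ho; tauto.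
Qed.

Lemma Def_app1 (P : M -> Prop) t :
  Def (fun e => P (e 0)) -> Term t -> Def (fun e => P (t e)).
Proof.
  intros H Ht; apply (Def_subst (t := fun _ => t) (fun _ => Ht) H).
Qed.

Lemma Def_app2 (P : M -> M -> Prop) t u :
  Def (fun e => P (e 0) (e 1)) -> Term t -> Term u -> Def (fun e => P (t e) (u e)).
Proof.
  intros H Ht Hu.
  apply (Def_subst (t := fun i => match i with 0 => t | _ => u end)
           (P := fun e => P (e 0) (e 1))); [intros [|i]|]; assumption.
Qed.

Lemma Def_app3 (P : M -> M -> M -> Prop) t u v :
  Def (fun e => P (e 0) (e 1) (e 2)) -> Term t -> Term u -> Term v ->
  Def (fun e => P (t e) (u e) (v e)).
Proof.
  intros H Ht Hu Hv.
  apply (Def_subst (t := fun i => match i with 0 => t | 1 => u | _ => v end)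
           (P := fun e => P (e 0) (e 1) (e 2))); [intros [|[|i]]|]; assumption.
Qed.

End Definability.

Ltac term := first [apply Term_var | apply Term_const].

(** Defined predicates are looked up in the context and in the hint database
    [def]; the remaining ones are unfolded by [unf]. *)
Ltac def_with unf :=
  cbv beta;
  lazymatch goal with
  | |- Def (fun _ => ?P) => apply (Def_prop _ P)
  | |- Def (fun e => exists x, @?Q e x) =>
      apply (Def_ex (Q := fun x e => Q e x)); def_with unf
  | |- Def (fun e => @?P e /\ @?Q e) => apply (Def_and (P := P) (Q := Q)); def_with unf
  | |- Def (fun e => @?P e \/ @?Q e) => apply (Def_or (P := P) (Q := Q)); def_with unf
  | |- Def (fun e => @?P e <-> @?Q e) => apply (Def_equiv (P := P) (Q := Q)); def_with unf
  | |- Def (fun e => ~ @?P e) => apply (Def_not (P := P)); def_with unf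
  | |- Def (fun e => forall x : carrier _, @?Q e x) =>
      apply (Def_all (Q := fun x e => Q e x)); def_with unf
  | |- Def (fun e => @?P e -> @?Q e) => apply (Def_imp (P := P) (Q := Q)); def_with unf
  | |- Def (fun e => mem (@?t e) (@?u e)) => apply (Def_mem (t := t) (u := u)); term
  | |- Def (fun e => @?t e = @?u e) => apply (Def_eq (t := t) (u := u)); term
  | |- Def (fun e => ur (@?t e)) => apply (Def_ur (t := t)); term
  | |- _ =>
    first
    [ lazymatch goal with
      | |- Def (fun e => ?P (@?t e)) => apply (Def_app1 (P := P) (t := t))
      end; [solve [eauto with def] | term]
    | lazymatch goal with
      | |- Def (fun e => ?P (@?t e) (@?u e)) =>
          apply (Def_app2 (P := P) (t := t) (u := u))
      end; [solve [eauto with def] | term | term]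
    | lazymatch goal with
      | |- Def (fun e => ?P (@?t e) (@?u e) (@?v e)) =>
          apply (Def_app3 (P := P) (t := t) (u := u) (v := v))
      end; [solve [eauto with def] | term | term | term]
    | progress unf; def_with unf ]
  end.

Create HintDb def.

Ltac def0 := def_with ltac:(unfold is_set, subset, disjoint, transitive_set, unique).

Lemma Def_is_pair (M : structure) :
  Def (M := M) (fun e => is_pair (e 0) (e 1) (e 2)).
Proof. unfold is_pair; def0. Qed.

#[export] Hint Resolve Def_is_pair : def.

Lemma Def_related (M : structure) :
  Def (M := M) (fun e => related (e 0) (e 1) (e 2)).
Proof. unfold related; def0. Qed.

#[export] Hint Resolve Def_related : def.

Ltac def := def_with ltac:(unfold is_set, subset, disjoint, transitive_set, unique,
  is_relation, is_function, is_injection, is_bijection, injects, equinumerous,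
  set_of_urelements, strict_well_order).

(** * Pairs, functions and bijections; duplication *)

Section Basics.

Context (M : structure) (hM : ZFUR M).

Local Notation "x ∈ y" := (mem x y) (at level 70, no associativity).

Lemma mem_is_set (x y : M) : x ∈ y -> is_set y.
Proof. intros H U; exact (zfu_urelements hM U H). Qed.

Lemma ext (x y : M) : is_set x -> is_set y -> (forall z, z ∈ x <-> z ∈ y) -> x = y.
Proof. apply (zfu_extensionality hM). Qed.

Lemma separation (P : M -> Prop) (x : M) :
  Def (fun e => P (e 0)) -> is_set x ->
  exists y, is_set y /\ forall z, z ∈ y <-> z ∈ x /\ P z.
Proof.
  intros (phi & tau & H) hx.
  (* [P] looks only at [e 0], so the environment may be taken constant and all variables read from
     it merged into index 0. *)
  destruct (zfu_separation hM
    (rename (fun i => match tau i with inl _ => 0 | inr _ => S i end) phi)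
    (fun i => match tau i with inl _ => x | inr c => c end) hx) as (y & hy & Hy).
  exists y; split; [exact hy|]; intro z; rewrite Hy, (H (fun _ => z)), sat_rename.
  assert (E : forall A B C : Prop, (B <-> C) -> (A /\ B <-> A /\ C)) by tauto.
  apply E, sat_ext; intro i.
  destruct (tau i) as [j|c] eqn:Hi; unfold scons; rewrite ?Hi; reflexivity.
Qed.

Lemma replacement (P : M -> M -> Prop) (w : M) :
  Def (fun e => P (e 0) (e 1)) -> is_set w ->
  (forall x y y', x ∈ w -> P x y -> P x y' -> y = y') ->
  exists v, is_set v /\ forall y, y ∈ v <-> exists x, x ∈ w /\ P x y.
Proof.
  intros D hw F.
  (* The scheme wants exactly one value for each argument, whereas [P] may be partial on [w]; its
     domain is cut out first. *)
  destruct (@separation (fun x => exists y, P x y) w) as (w' & hw' & Hw');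
    [def|exact hw|].
  pose proof D as (phi & tau & H).
  (* The scheme has the value at index 0 and the argument at index 1, the reverse of [P]. *)
  pose (s i := match tau i with inl 0 => 1 | inl _ => 0 | inr _ => S (S i) end).
  pose (rho i := match tau i with inl _ => w | inr c => c end).
  assert (E : forall x y, sat (scons y (scons x rho)) (rename s phi) <-> P x y).
  { intros x y; rewrite (H (scons x (fun _ => y))), sat_rename; apply sat_ext; intro i.
    unfold s, rho, scons; destruct (tau i) as [[|j]|c] eqn:Hi; rewrite ?Hi; reflexivity. }
  destruct (zfu_replacement hM (phi := rename s phi) (rho := rho) hw')
    as (v & hv & Hv).
  { intros x Hx; apply Hw' in Hx as (Hx & y & Hy); exists y; split.
    - apply E, Hy.
    - intros y' Hy'; apply E in Hy'; eauto. }
  destruct (@separation (fun y => exists x, x ∈ w /\ P x y) v) as (u & hu & Hu);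
    [def|exact hv|].
  exists u; split; [exact hu|]; intro y; rewrite Hu; split; [tauto|].
  intros (x & Hx & Hy); split; [|eauto].
  destruct (Hv x) as (y' & Hy' & K); [apply Hw'; eauto|].
  apply E in K; rewrite (F x y y'); auto.
Qed.

Lemma empty_set : exists x : M, is_set x /\ forall z, ~ z ∈ x.
Proof.
  destruct (zfu_infinity hM) as (_ & _ & (e & _ & He) & _); exists e; exact He.
Qed.

Lemma singleton (a : M) : exists x, is_set x /\ forall z, z ∈ x <-> z = a.
Proof.
  destruct (zfu_pairing hM a a) as (x & hx & Hx); exists x; split; [exact hx|].
  intro z; rewrite Hx; tauto.
Qed.

Lemma binary_union (x y : M) : is_set x -> is_set y ->
  exists u, is_set u /\ forall z, z ∈ u <-> z ∈ x \/ z ∈ y.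
Proof.
  intros hx hy; destruct (zfu_pairing hM x y) as (p & hp & Hp).
  destruct (zfu_union hM hp) as (u & hu & Hu); exists u; split; [exact hu|].
  intro z; rewrite Hu; split.
  - intros (w & Hw & Hz); apply Hp in Hw as [-> | ->]; auto.
  - intros [Hz|Hz]; [exists x|exists y]; rewrite Hp; auto.
Qed.

Lemma adjoin (x a : M) : is_set x ->
  exists u, is_set u /\ forall z, z ∈ u <-> z ∈ x \/ z = a.
Proof.
  intro hx; destruct (singleton a) as (s & hs & Hs).
  destruct (binary_union hx hs) as (u & hu & Hu); exists u; split; [exact hu|].
  intro z; rewrite Hu, Hs; tauto.
Qed.

Lemma difference (x y : M) : is_set x ->
  exists u, is_set u /\ forall z, z ∈ u <-> z ∈ x /\ ~ z ∈ y.
Proof. intro hx; apply separation; [def|exact hx]. Qed.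

Lemma mem_asym (x y : M) : x ∈ y -> ~ y ∈ x.
Proof.
  intros Hx Hy; destruct (zfu_pairing hM x y) as (s & hs & Hs).
  destruct (zfu_foundation hM (x := s)) as (z & Hz & D); [exists x; apply Hs; auto|].
  apply Hs in Hz as [-> | ->].
  - apply (D y); split; [exact Hy|apply Hs; auto].
  - apply (D x); split; [exact Hx|apply Hs; auto].
Qed.

Lemma pair_exists (a b : M) : exists p, is_set p /\ is_pair p a b.
Proof.
  destruct (singleton a) as (u & hu & Hu).
  destruct (zfu_pairing hM a b) as (v & hv & Hv).
  destruct (zfu_pairing hM u v) as (p & hp & Hp).
  exists p; split; [exact hp|]; exists u, v; auto.
Qed.

Lemma pair_inj (p a b c d : M) : is_pair p a b -> is_pair p c d -> a = c /\ b = d.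
Proof.
  intros (u & v & Hu & Hv & Hp) (u' & v' & Hu' & Hv' & Hp').
  assert (hu : u = u' \/ u = v') by (apply Hp', Hp; auto).
  assert (hv : v = u' \/ v = v') by (apply Hp', Hp; auto).
  assert (hu' : u' = u \/ u' = v) by (apply Hp, Hp'; auto).
  assert (hv' : v' = u \/ v' = v) by (apply Hp, Hp'; auto).
  assert (a = c).
  { destruct hu' as [<- | <-].
    - symmetry; apply Hu, Hu'; auto.
    - apply Hu', Hv; auto. }
  subst c; split; [reflexivity|].
  assert (Hb : b ∈ v) by (apply Hv; auto).
  assert (Hd : d ∈ v') by (apply Hv'; auto).
  destruct hv as [-> | ->].
  - apply Hu' in Hb as ->.
    destruct hv' as [-> | ->]; [apply Hu in Hd|apply Hu' in Hd]; auto.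
  - apply Hv' in Hb as [-> |Hb]; [|exact Hb].
    apply Hv in Hd as [-> |Hd]; auto.
Qed.

Lemma pair_unique (p q a b : M) : is_pair p a b -> is_pair q a b -> p = q.
Proof.
  intros (u & v & Hu & Hv & Hp) (u' & v' & Hu' & Hv' & Hp').
  assert (u = u') as <-.
  { apply ext; [apply mem_is_set with a, Hu|apply mem_is_set with a, Hu'|]; auto.
    intro z; rewrite Hu, Hu'; tauto. }
  assert (v = v') as <-.
  { apply ext; [apply mem_is_set with a, Hv|apply mem_is_set with a, Hv'|]; auto.
    intro z; rewrite Hv, Hv'; tauto. }
  apply ext; [apply mem_is_set with u, Hp|apply mem_is_set with u, Hp'|]; auto.
  intro z; rewrite Hp, Hp'; tauto.
Qed.

Lemma related_adjoin (f a b : M) : is_set f ->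
  exists g, is_set g /\ forall c d, related g c d <-> related f c d \/ c = a /\ d = b.
Proof.
  intro hf; destruct (pair_exists a b) as (p & hp & Hp).
  destruct (adjoin p hf) as (g & hg & Hg); exists g; split; [exact hg|].
  intros c d; split.
  - intros (q & Hq & Hqg); apply Hg in Hqg as [Hqf| ->]; [left; exists q; auto|].
    right; destruct (pair_inj Hp Hq); auto.
  - intros [(q & Hq & Hqf)|[-> ->]]; [exists q|exists p]; rewrite Hg; auto.
Qed.

Lemma product (X Y : M) : is_set X -> is_set Y ->
  exists P, is_set P /\
    forall p, p ∈ P <-> exists a b, a ∈ X /\ b ∈ Y /\ is_pair p a b.
Proof.
  intros hX hY; destruct (binary_union hX hY) as (U & hU & HU).
  destruct (zfu_powerset hM hU) as (PU & hPU & HPU).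
  destruct (zfu_powerset hM hPU) as (PPU & hPPU & HPPU).
  destruct (@separation (fun p => exists a b, a ∈ X /\ b ∈ Y /\ is_pair p a b) PPU)
    as (P & hP & HP); [def|exact hPPU|].
  exists P; split; [exact hP|]; intro p; rewrite HP; split; [tauto|].
  intros (a & b & Ha & Hb & Hp); split; [|eauto].
  destruct Hp as (u & v & Hu & Hv & Hp).
  apply HPPU; split; [apply mem_is_set with u, Hp; auto|].
  intros z Hz; apply HPU; apply Hp in Hz as [-> | ->]; split;
    try (apply mem_is_set with a; first [apply Hu|apply Hv]; auto).
  - intros w Hw; apply Hu in Hw as ->; apply HU; auto.
  - intros w Hw; apply Hv in Hw as [-> | ->]; apply HU; auto.
Qed.

Lemma relation_comprehension (P : M -> M -> Prop) (X Y : M) :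
  Def (fun e => P (e 0) (e 1)) -> is_set X -> is_set Y ->
  exists r, is_relation r X Y /\
    forall a b, related r a b <-> a ∈ X /\ b ∈ Y /\ P a b.
Proof.
  intros D hX hY; destruct (product hX hY) as (Q & hQ & HQ).
  destruct (@separation (fun p => exists a b, is_pair p a b /\ P a b) Q)
    as (r & hr & Hr); [def|exact hQ|].
  exists r; split.
  - split; [exact hr|]; intros p Hp; apply Hr in Hp as [Hp _]; apply HQ, Hp.
  - intros a b; split.
    + intros (p & Hp & Hpr); apply Hr in Hpr as (H1 & c & d & Hcd & K).
      apply HQ in H1 as (a' & b' & Ha & Hb & Hab).
      destruct (pair_inj Hp Hab) as [<- <-]; destruct (pair_inj Hp Hcd) as [<- <-]; auto.
    + intros (Ha & Hb & K); destruct (pair_exists a b) as (p & _ & Hp).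
      exists p; split; [exact Hp|]; apply Hr; split; [apply HQ|]; eauto 6.
Qed.

Lemma function_comprehension (P : M -> M -> Prop) (X : M) :
  Def (fun e => P (e 0) (e 1)) -> is_set X ->
  (forall x y y', x ∈ X -> P x y -> P x y' -> y = y') ->
  exists r, is_set r /\ forall a b, related r a b <-> a ∈ X /\ P a b.
Proof.
  intros D hX F; destruct (replacement D hX F) as (Y & hY & HY).
  destruct (relation_comprehension D hX hY) as (r & [hr _] & Hr).
  exists r; split; [exact hr|]; intros a b; rewrite Hr, HY; split; [tauto|].
  intros []; eauto.
Qed.

(** Bijections without the requirement that [f] has no other elements than the
    relevant pairs. *)
Definition bij (f X Y : M) : Prop :=
  (forall a b, related f a b -> a ∈ X /\ b ∈ Y) /\
  (forall a, a ∈ X -> exists b, related f a b) /\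
  (forall b, b ∈ Y -> exists a, related f a b) /\
  (forall a b b', related f a b -> related f a b' -> b = b') /\
  (forall a a' b, related f a b -> related f a' b -> a = a').

Lemma injection_spec (f X Y : M) : is_injection f X Y ->
  (forall a b, related f a b -> a ∈ X /\ b ∈ Y) /\
  (forall a, a ∈ X -> exists b, related f a b) /\
  (forall a b b', related f a b -> related f a b' -> b = b') /\
  (forall a a' b, related f a b -> related f a' b -> a = a').
Proof.
  intros (((hf & Hf) & F) & I).
  assert (K : forall a b, related f a b -> a ∈ X /\ b ∈ Y).
  { intros a b (p & Hp & Hpf); destruct (Hf p Hpf) as (c & d & Hc & Hd & Hcd).
    destruct (pair_inj Hp Hcd) as [-> ->]; auto. }
  repeat split; try (eapply K; eassumption).
  - intros a Ha; destruct (F a Ha) as (b & Hb & _); eauto.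
  - intros a b b' Hb Hb'; destruct (F a) as (c & _ & U); [eapply K; eassumption|].
    rewrite <- (U b Hb); auto.
  - exact I.
Qed.

Lemma bijection_bij (f X Y : M) : is_bijection f X Y -> bij f X Y.
Proof.
  intros (I & S); destruct (injection_spec I) as (H1 & H2 & H3 & H4).
  repeat split; auto; eapply H1; eassumption.
Qed.

Lemma class_bijection (P : M -> M -> Prop) (X Y : M) :
  Def (fun e => P (e 0) (e 1)) -> is_set X -> is_set Y ->
  (forall a, a ∈ X -> exists b, b ∈ Y /\ P a b) ->
  (forall b, b ∈ Y -> exists a, a ∈ X /\ P a b) ->
  (forall a b b', a ∈ X -> b ∈ Y -> b' ∈ Y -> P a b -> P a b' -> b = b') ->
  (forall a a' b, a ∈ X -> a' ∈ X -> b ∈ Y -> P a b -> P a' b -> a = a') ->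
  exists f, is_bijection f X Y /\
    forall a b, related f a b <-> a ∈ X /\ b ∈ Y /\ P a b.
Proof.
  intros D hX hY T S F I.
  destruct (relation_comprehension D hX hY) as (f & Rf & Hf).
  exists f; split; [|exact Hf]; repeat split; try apply Rf.
  - intros a Ha; destruct (T a Ha) as (b & Hb & K); exists b; split.
    + apply Hf; auto.
    + intros b' Hb'; apply Hf in Hb' as (? & ? & ?); eauto.
  - intros a a' b Ha Ha'; apply Hf in Ha as (? & ? & ?), Ha' as (? & ? & ?); eauto.
  - intros b Hb; destruct (S b Hb) as (a & Ha & K); exists a; apply Hf; auto.
Qed.

(** By Cantor's diagonal argument, the injection [f] from [A × P(A)] maps some
    definable point of each column [{a} × P(A)] outside [A]. *)
Lemma plenitude_duplication : PlenitudePlus M -> Duplication M.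
Proof.
  intros Pl A (hA & HA).
  destruct (zfu_powerset hM hA) as (PA & hPA & HPA).
  destruct (product hA hPA) as (X & hX & HX).
  destruct (Pl X hX) as (C & (hC & HC) & (f & Hf)).
  apply bijection_bij in Hf as (F1 & F2 & F3 & F4 & F5).
  (* [Y] collects the members of [A] that are the image of some pair [(a, Y')] without belonging to
     [Y']. As [f] is injective, the image of [(a, Y)] cannot lie in [A]: it would be in [Y] exactly
     when it is not. *)
  pose (Diag a Y := is_set Y /\ forall b, b ∈ Y <-> b ∈ A /\
    exists Y' p', is_pair p' a Y' /\ related f p' b /\ ~ b ∈ Y').
  pose (P c a := exists p Y, is_pair p a Y /\ related f p c /\ Diag a Y).
  assert (DP : Def (fun e => P (e 0) (e 1))) by (unfold P, Diag; def).
  destruct (@separation (fun c => exists a, a ∈ A /\ P c a) C) as (B & hB & HB);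
    [def|exact hC|].
  exists B; split; [|split].
  - split; [exact hB|]; intros c Hc; apply HB in Hc as [Hc _]; auto.
  - intros c [Hc HcA]; apply HB in Hc as (_ & a & Ha & p & Y & Hp & Hpc & hY & HY).
    assert (N : ~ c ∈ Y).
    { intro K; apply HY in K as K'; destruct K' as (_ & Y' & p' & Hp' & Hpc' & N).
      rewrite (F5 p p' c Hpc Hpc') in Hp.
      destruct (pair_inj Hp Hp') as [_ <-]; auto. }
    apply N, HY; eauto 6.
  - destruct (@class_bijection P B A) as (g & Hg & _); [exact DP|exact hB|exact hA|..].
    + intros c Hc; apply HB in Hc as (_ & Hc); exact Hc.
    + intros a Ha.
      destruct (@separation (fun b => exists Y' p', is_pair p' a Y' /\
        related f p' b /\ ~ b ∈ Y') A) as (Y & hY & HY); [def|exact hA|].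
      destruct (pair_exists a Y) as (p & _ & Hp).
      assert (HpX : p ∈ X).
      { apply HX; exists a, Y; repeat split; auto; apply HPA; split; [exact hY|].
        intros z Hz; apply HY, Hz. }
      destruct (F2 p HpX) as (c & Hc).
      assert (K : P c a) by (exists p, Y; unfold Diag; auto).
      exists c; split; [|exact K]; apply HB; split; [eapply F1|]; eauto.
    + intros c a a' _ _ _ (p & Y & Hp & Hpc & _) (p' & Y' & Hp' & Hpc' & _).
      rewrite (F5 p p' c Hpc Hpc') in Hp; apply (pair_inj Hp Hp').
    + intros c c' a _ _ _ (p & Y & Hp & Hpc & hY & HY) (p' & Y' & Hp' & Hpc' & hY' & HY').
      assert (Y = Y') as <- by (apply ext; auto; intro z; rewrite HY, HY'; tauto).
      rewrite (pair_unique Hp Hp') in Hpc; eauto.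
    + exists g; exact Hg.
Qed.

End Basics.


(** * Induction and levels *)

Section Induction.

Context (M : structure) (hM : ZFUR M).

Local Notation "x ∈ y" := (mem x y) (at level 70, no associativity).

(** The values [G^n(x0)] are the [y] with [R n y] for some [n] in the inductive
    set of the axiom of infinity. *)
Lemma closed_set (G : M -> M -> Prop) (x0 : M) :
  Def (fun e => G (e 0) (e 1)) -> (forall x, exists! y, G x y) ->
  exists v, is_set v /\ x0 ∈ v /\ forall y z, y ∈ v -> G y z -> z ∈ v.
Proof.
  intros D T.
  assert (F : forall x y y', G x y -> G x y' -> y = y').
  { intros x y y' Hy Hy'; destruct (T x) as (z & _ & U).
    rewrite <- (U y Hy); auto. }
  destruct (zfu_infinity hM) as (N & hN & (e & He & he & He0) & HN).
  pose (succ (n m : M) := is_set m /\ forall z, z ∈ m <-> z ∈ n \/ z = n).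
  assert (succ_inj : forall n n' m, succ n m -> succ n' m -> n = n').
  { intros n n' m [_ Hm] [_ Hm'].
    assert (H1 : n ∈ n' \/ n = n') by (apply Hm', Hm; auto).
    assert (H2 : n' ∈ n \/ n' = n) by (apply Hm, Hm'; auto).
    destruct H1 as [H1|]; [|auto]; destruct H2 as [H2|]; [|auto].
    destruct (mem_asym hM H1 H2). }
  (* An approximation is only asked that each of its pairs be the initial one or come from an
     earlier one; existence and uniqueness of values are derived afterwards. *)
  pose (good f := forall m z : M, related f m z -> (m = e /\ z = x0) \/
    exists m' z', succ m' m /\ G z' z /\ related f m' z').
  pose (R (n y : M) := exists f, is_set f /\ good f /\ related f n y).
  assert (DR : Def (fun e => R (e 0) (e 1))) by (unfold R, good, succ; def).
  assert (R0 : R e x0).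
  { destruct (related_adjoin hM e x0 he) as (f & hf & Hf).
    exists f; split; [exact hf|split; [|apply Hf; auto]].
    intros m z Hz; apply Hf in Hz as [(p & _ & Hp)|Hz]; [destruct (He0 _ Hp)|auto]. }
  assert (U0 : forall y, R e y -> y = x0).
  { intros y (f & _ & Hf & Hy); destruct (Hf _ _ Hy) as [[_ ->]|(m & z & [_ Hm] & _)];
      [reflexivity|]; destruct (He0 m); apply Hm; auto. }
  assert (RS : forall n m y z, succ n m -> R n y -> G y z -> R m z).
  { intros n m y z Hnm (f & hf & Hf & Hy) Hz.
    destruct (related_adjoin hM m z hf) as (g & hg & Hg).
    exists g; split; [exact hg|split; [|apply Hg; auto]].
    intros m' z' Hz'; apply Hg in Hz' as [Hz'|[-> ->]].
    - destruct (Hf _ _ Hz') as [K|(m1 & z1 & K1 & K2 & K3)]; [auto|].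
      right; exists m1, z1; rewrite Hg; auto.
    - right; exists n, y; rewrite Hg; auto. }
  assert (US : forall n m z, succ n m -> R m z -> exists y, R n y /\ G y z).
  { intros n m z Hnm (f & hf & Hf & Hz).
    destruct (Hf _ _ Hz) as [[-> ->]|(m1 & z1 & K1 & K2 & K3)].
    - destruct (He0 n); apply Hnm; auto.
    - rewrite (succ_inj _ _ _ K1 Hnm) in K3; exists z1; split; [exists f|]; auto. }
  pose (U (n : M) := exists y, R n y /\ forall y', R n y' -> y' = y).
  assert (US' : forall n m, succ n m -> U n -> U m).
  { intros n m Hnm (y & Hy & Uy); destruct (T y) as (z & Hz & _).
    exists z; split; [eauto|]; intros z' Hz'.
    destruct (US _ _ _ Hnm Hz') as (y' & Hy' & K); rewrite (Uy y' Hy') in K; eauto. }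
  (* [N] may contain more than the natural numbers. Its subset of points with a unique value
     contains zero and is closed under successor, which replaces an induction. *)
  destruct (@separation _ hM U N) as (w & hw & Hw); [unfold U; def|exact hN|].
  destruct (@replacement _ hM R w) as (v & hv & Hv); [exact DR|exact hw| |].
  { intros n y y' Hn Hy Hy'; apply Hw in Hn as (_ & z & _ & Uz).
    rewrite (Uz y), (Uz y'); auto. }
  exists v; split; [exact hv|split].
  - apply Hv; exists e; split; [|exact R0]; apply Hw; split; [exact He|].
    exists x0; auto.
  - intros y z Hy Hz; apply Hv in Hy as (n & Hn & Hy); apply Hw in Hn as [HnN Un].
    destruct (HN n HnN) as (m & HmN & Hm); apply Hv; exists m; split.
    + apply Hw; split; [exact HmN|]; eapply US'; eauto.
    + eapply RS; eauto.
Qed.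

(** Iterating the union from [{x}] rather than from [x] makes [x] a member and covers urelements;
    [G] is total because it sends an urelement to the empty set. *)
Lemma transitive_closure (x : M) : exists t, transitive_set t /\ x ∈ t.
Proof.
  destruct (singleton hM x) as (s & hs & Hs).
  pose (G (y z : M) := is_set z /\ forall w, w ∈ z <-> exists u, u ∈ y /\ w ∈ u).
  destruct (@closed_set G s) as (v & hv & Hv & Cv).
  - unfold G; def.
  - intro y; destruct (classic (is_set y)) as [hy|hy].
    + destruct (zfu_union hM hy) as (z & hz & Hz); exists z; split; [split; auto|].
      intros z' [hz' Hz']; apply (ext hM); auto; intro w; rewrite Hz, Hz'; tauto.
    + destruct (empty_set hM) as (z & hz & Hz); exists z; split.
      * split; [exact hz|]; intro w; split; [intro K; destruct (Hz w K)|].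
        intros (u & Hu & _); destruct hy; apply (mem_is_set hM Hu).
      * intros z' [hz' Hz']; apply (ext hM); auto; intro w; rewrite Hz'; split.
        -- intro K; destruct (Hz w K).
        -- intros (u & Hu & _); destruct hy; apply (mem_is_set hM Hu).
  - destruct (zfu_union hM hv) as (t & ht & Ht); exists t; split; [split; [exact ht|]|].
    + intros y z Hy Hz; apply Ht in Hy as (u & Hu & Hy).
      assert (hu : is_set u) by apply (mem_is_set hM Hy).
      destruct (zfu_union hM hu) as (u' & hu' & Hu'); apply Ht; exists u'; split.
      * apply (Cv u u'); [|split]; auto.
      * apply Hu'; eauto.
    + apply Ht; exists s; split; [exact Hv|apply Hs; reflexivity].
Qed.

Lemma mem_induction (P : M -> Prop) :
  Def (fun e => P (e 0)) -> (forall x, (forall y, y ∈ x -> P y) -> P x) ->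
  forall x, P x.
Proof.
  intros D H x; apply NNPP; intro Nx.
  destruct (transitive_closure x) as (t & [ht Ht] & Hx).
  destruct (@separation _ hM (fun y => ~ P y) t) as (s & hs & Hs); [def|exact ht|].
  destruct (zfu_foundation hM (x := s)) as (y & Hy & Dy); [exists x; apply Hs; auto|].
  apply Hs in Hy as [Hyt Hy]; apply Hy, H; intros z Hz; apply NNPP; intro Nz.
  apply (Dy z); split; [exact Hz|]; apply Hs; split; [|exact Nz]; eapply Ht; eauto.
Qed.

Lemma mem_minimal (P : M -> Prop) (x : M) :
  Def (fun e => P (e 0)) -> P x -> exists y, P y /\ forall z, z ∈ y -> ~ P z.
Proof.
  intros D Px; apply NNPP; intro N.
  assert (K : forall y, ~ P y); [|exact (K x Px)].
  apply mem_induction; [def|]; intros y Hy Py; apply N; exists y; auto.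
Qed.

End Induction.

(** * The cumulative hierarchy over a set of urelements *)

Section Levels.

Context (M : structure) (hM : ZFUR M) (A : M) (hA : set_of_urelements A).

Local Notation "x ∈ y" := (mem x y) (at level 70, no associativity).

(** [y] belongs to the cumulative hierarchy over the urelements in [K]. *)
Definition supported (K : M -> Prop) (y : M) : Prop :=
  exists t, transitive_set t /\ y ∈ t /\ forall u, u ∈ t -> ur u -> K u.

(** Approximations to the recursion L(a) = A ∪ ⋃{P(L(c)) : c ∈ a}. Indexing by arbitrary elements
    avoids ordinals, and single-valuedness is left to be proved by ∈-induction. *)
Definition rank_approx (f : M) : Prop :=
  forall a b, related f a b ->
    is_set b /\ (forall c, c ∈ a -> exists d, related f c d) /\
    forall z, z ∈ b <->
      z ∈ A \/ is_set z /\ exists c d, c ∈ a /\ related f c d /\ subset z d.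

(** [L] is the level of the cumulative hierarchy over [A] indexed by the rank
    of [x]. *)
Definition level_at (x L : M) : Prop := exists f, rank_approx f /\ related f x L.

Definition level (L : M) : Prop := exists x, level_at x L.

Lemma Def_level_at : Def (fun e => level_at (e 0) (e 1)).
Proof. unfold level_at, rank_approx; def. Qed.

Hint Resolve Def_level_at : def.

Lemma Def_level : Def (fun e => level (e 0)).
Proof. unfold level; def. Qed.

Lemma level_at_unique x L L' : level_at x L -> level_at x L' -> L = L'.
Proof.
  revert x L L'.
  apply (mem_induction hM (P := fun x => forall L L',
    level_at x L -> level_at x L' -> L = L')); [def|].
  assert (Incl : forall x L L', (forall y, y ∈ x -> forall L L',
    level_at y L -> level_at y L' -> L = L') ->
    level_at x L -> level_at x L' -> forall z, z ∈ L -> z ∈ L').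
  { intros x L L' IH (f & Hf & HL) (f' & Hf' & HL') z Hz.
    destruct (Hf _ _ HL) as (_ & _ & E), (Hf' _ _ HL') as (_ & T & E').
    apply E'; apply E in Hz as [Hz|(hz & c & d & Hc & Hd & Hzd)]; [auto|right].
    split; [exact hz|]; destruct (T c Hc) as (d' & Hd').
    exists c, d'; repeat split; auto.
    rewrite (IH c Hc d' d); auto; [exists f'|exists f]; auto. }
  intros x IH L L' HL HL'; apply (ext hM).
  - destruct HL as (f & Hf & HL); apply (Hf _ _ HL).
  - destruct HL' as (f & Hf & HL'); apply (Hf _ _ HL').
  - intro z; split; eapply Incl; eauto.
Qed.

Lemma level_at_exists x : exists L, level_at x L.
Proof.
  revert x; apply (mem_induction hM (P := fun x => exists L, level_at x L)); [def|].
  intros x IH; apply NNPP; intro N.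
  destruct (transitive_closure hM x) as (t & [ht Ht] & Hx).
  destruct (@function_comprehension _ hM level_at t) as (f & hf & Hf);
    [def|exact ht|intros; eapply level_at_unique; eauto|].
  assert (Af : forall c d, c ∈ x -> level_at c d -> related f c d)
    by (intros; apply Hf; split; auto; eapply Ht; eauto).
  (* Replacement requires [x] to be a set. If it were an urelement, the single pair [(x, A)] would
     be an approximation, against [N]. *)
  destruct (@replacement _ hM level_at x) as (r & hr & Hr); [def| | |].
  { intro u; apply N; destruct (singleton hM x) as (s & hs & Hs).
    destruct (empty_set hM) as (e & he & He).
    destruct (related_adjoin hM x A he) as (g & hg & Hg).
    exists A, g; split; [|apply Hg; auto].
    intros a b Hab; apply Hg in Hab as [(p & _ & Hp)|[-> ->]]; [destruct (He _ Hp)|].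
    split; [apply hA|split; [intros c Hc; destruct (zfu_urelements hM u Hc)|]].
    intro z; split; [auto|]; intros [Hz|(_ & c & _ & Hc & _)]; [exact Hz|].
    destruct (zfu_urelements hM u Hc). }
  { intros; eapply level_at_unique; eauto. }
  destruct (zfu_union hM hr) as (u & hu & Hu).
  destruct (zfu_powerset hM hu) as (p & hp & Hp).
  destruct (binary_union hM (x := A) (y := p)) as (q & hq & Hq); [apply hA|exact hp|].
  destruct (@separation _ hM (fun z => z ∈ A \/ is_set z /\ exists c d, c ∈ x /\
    related f c d /\ subset z d) q) as (L & hL & HL); [def|exact hq|].
  assert (HL' : forall z, z ∈ L <-> z ∈ A \/ is_set z /\ exists c d, c ∈ x /\
    related f c d /\ subset z d).
  { intro z; rewrite HL; split; [tauto|]; intro K; split; [|exact K].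
    apply Hq; destruct K as [K|(hz & c & d & Hc & Hd & Hzd)]; [auto|right].
    apply Hp; split; [exact hz|]; intros w Hw; apply Hu; exists d; split; [|auto].
    apply Hr; exists c; split; [exact Hc|]; apply Hf, Hd. }
  apply N; destruct (related_adjoin hM x L hf) as (g & hg & Hg).
  exists L, g; split; [|apply Hg; auto].
  (* The adjoined pair disturbs no earlier value: were [c = x], then [x] would have a level, against
     [N]. *)
  assert (Eg : forall a c d, c ∈ a -> (forall c, c ∈ a -> exists d, level_at c d) ->
    (related g c d <-> related f c d)).
  { intros a c d Hc Ta; rewrite Hg; split; [|auto]; intros [K|[-> ->]]; [auto|].
    destruct (N (Ta x Hc)). }
  intros a b Hab.
  assert (Ta : forall c, c ∈ a -> exists d, level_at c d).
  { apply Hg in Hab as [Hab|[-> ->]]; [|exact IH].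
    apply Hf in Hab as [Ha (h & Hh & Hab)].
    intros c Hc; destruct (Hh _ _ Hab) as (_ & T & _); destruct (T c Hc) as (d & Hd).
    exists d, h; auto. }
  apply Hg in Hab as [Hab|[-> ->]].
  - apply Hf in Hab as [Ha (h & Hh & Hab)].
    destruct (Hh _ _ Hab) as (hb & T & E); split; [exact hb|split].
    + intros c Hc; destruct (T c Hc) as (d & Hd); exists d; apply Hg; left.
      apply Hf; split; [eapply Ht; eauto|exists h; auto].
    + intro z; rewrite E.
      assert (E' : forall c d, c ∈ a -> (related h c d <-> related g c d)).
      { intros c d Hc; rewrite (Eg a c d Hc Ta), Hf; split.
        - intro K; split; [eapply Ht; eauto|exists h; auto].
        - intros [_ K]; destruct (T c Hc) as (d' & Hd').
          rewrite (level_at_unique K (L' := d')); [exact Hd'|exists h; auto]. }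
      split; (intros [K|(hz & c & d & Hc & Hd & Hz)]; [auto|right; split; [exact hz|]]);
        exists c, d; split; auto; split; auto; apply E'; auto.
  - split; [exact hL|split].
    + intros c Hc; destruct (IH c Hc) as (d & Hd); exists d; apply Hg; auto.
    + intro z; rewrite HL'.
      split; (intros [K|(hz & c & d & Hc & Hd & Hz)]; [auto|right; split; [exact hz|]]);
        exists c, d; split; auto; split; auto; apply (Eg _ _ _ Hc Ta); auto.
Qed.

Lemma level_at_spec x L : level_at x L -> is_set L /\
  forall z, z ∈ L <->
    z ∈ A \/ is_set z /\ exists c d, c ∈ x /\ level_at c d /\ subset z d.
Proof.
  intros (f & Hf & HL); destruct (Hf _ _ HL) as (hL & T & E); split; [exact hL|].
  intro z; rewrite E; split; (intros [K|(hz & c & d & Hc & Hd & Hz)]; [auto|right;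
    split; [exact hz|]]); exists c, d; split; auto; split; auto.
  - exists f; auto.
  - destruct (T c Hc) as (d' & Hd').
    rewrite (level_at_unique Hd (L' := d')); [exact Hd'|exists f; auto].
Qed.

Lemma level_is_set L : level L -> is_set L.
Proof. intros (x & Hx); apply (level_at_spec Hx). Qed.

Lemma level_at_transitive x L : level_at x L -> transitive_set L.
Proof.
  revert x L; apply (mem_induction hM (P := fun x => forall L,
    level_at x L -> transitive_set L)); [def|].
  intros x IH L HL; destruct (level_at_spec HL) as (hL & E); split; [exact hL|].
  intros y z Hy Hz; apply E; apply E in Hy as [Hy|(hy & c & d & Hc & Hd & Hyd)].
  - destruct (zfu_urelements hM (a := y)) with z; [apply hA, Hy|exact Hz].
  - apply Hyd in Hz; destruct (IH c Hc d Hd) as [_ Td].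
    destruct (level_at_spec Hd) as (hd & Ed).
    pose proof Hz as Hz'; apply Ed in Hz' as [K|(hz & _)]; [auto|right].
    split; [exact hz|]; exists c, d; split; auto; split; auto.
    intros w Hw; eapply Td; eauto.
Qed.

Lemma level_transitive L : level L -> transitive_set L.
Proof. intros (x & Hx); eapply level_at_transitive; eauto. Qed.

Lemma level_at_mem x c L d : level_at x L -> level_at c d -> c ∈ x -> d ∈ L.
Proof.
  intros HL Hd Hc; apply (level_at_spec HL); right; split.
  - apply (level_at_spec Hd).
  - exists c, d; split; auto; split; auto; intros w Hw; exact Hw.
Qed.

Lemma level_at_subset_mem y d L : level_at y L -> d ∈ L -> is_set d ->
  forall z, is_set z -> subset z d -> z ∈ L.
Proof.
  intros HL Hd hd z hz Hz; apply (level_at_spec HL); right; split; [exact hz|].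
  apply (level_at_spec HL) in Hd as [Hd|(_ & c & d' & Hc & Hd' & K)].
  - destruct hd; apply hA, Hd.
  - exists c, d'; split; auto; split; auto; intros w Hw; auto.
Qed.

(** Let [z] be in [L] but not in [L']; it is included in some earlier level [d] of [L]. Every set in
    [L'] is included in some [d'] earlier than [L'], and by induction [d ⊆ d'] or [d' ∈ d]. The
    former would put [z] in [L']; the latter puts the set in [d]. So [L' ⊆ d], whence [L' ∈ L]. *)
Lemma level_at_compare x y L L' : level_at x L -> level_at y L' ->
  subset L L' \/ L' ∈ L.
Proof.
  revert x y L L'; apply (mem_induction hM (P := fun x => forall y L L',
    level_at x L -> level_at y L' -> subset L L' \/ L' ∈ L)); [def|].
  intros x IH y L L' HL HL'.
  destruct (classic (subset L L')) as [K|K]; [auto|right].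
  apply not_all_ex_not in K as (z & K); apply imply_to_and in K as (Hz & Nz).
  destruct (level_at_spec HL) as (hL & E), (level_at_spec HL') as (hL' & E').
  pose proof Hz as Hz'; apply E in Hz' as [H|(hz & c & d & Hc & Hd & Hzd)];
    [destruct Nz; apply E'; auto|].
  destruct (level_at_spec Hd) as (hd & Ed).
  apply E; right; split; [exact hL'|]; exists c, d; split; auto; split; auto.
  intros v Hv; apply E' in Hv as [Hv|(hv & c' & d' & Hc' & Hd' & Hvd)];
    [apply Ed; auto|].
  destruct (IH c Hc c' d d' Hd Hd') as [H|H].
  - destruct Nz; apply E'; right; split; auto; exists c', d'; split; auto; split; auto.
    intros w Hw; auto.
  - eapply level_at_subset_mem; eauto; apply (level_at_spec Hd').
Qed.

Lemma level_compare L L' : level L -> level L' -> subset L L' \/ L' ∈ L.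
Proof. intros (x & Hx) (y & Hy); eapply level_at_compare; eauto. Qed.

Lemma level_total L L' : level L -> level L' -> subset L L' \/ subset L' L.
Proof.
  intros HL HL'; destruct (level_compare HL HL') as [K|K]; [auto|right].
  intros z Hz; apply level_transitive in HL as [_ T]; eapply T; eauto.
Qed.

(** An ∈-minimal level with [P] is the least one by [level_compare]. Being unique, it makes
    Replacement applicable where only the existence of some level is known. *)
Lemma least_level (P : M -> Prop) L0 :
  Def (fun e => P (e 0)) -> level L0 -> P L0 ->
  exists L, level L /\ P L /\ forall L', level L' -> P L' -> subset L L'.
Proof.
  intros D HL0 P0; pose proof Def_level as DL.
  destruct (@mem_minimal _ hM (fun L => level L /\ P L) L0) as (L & (HL & PL) & Min);
    [def|auto|].
  exists L; split; [exact HL|split; [exact PL|]]; intros L' HL' PL'.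
  destruct (level_compare HL HL') as [K|K]; [exact K|]; destruct (Min L' K); auto.
Qed.

Lemma supported_mem K x y : supported K y -> x ∈ y -> supported K x.
Proof.
  intros (t & Ht & Hy & Kt) Hx; exists t; split; [exact Ht|split; [|exact Kt]].
  destruct Ht as [_ Ht]; eapply Ht; eauto.
Qed.

Lemma supported_level_at y L : supported (fun u => u ∈ A) y -> level_at y L ->
  y ∈ A \/ is_set y /\ subset y L.
Proof.
  revert y L; apply (mem_induction hM (P := fun y => forall L,
    supported (fun u => u ∈ A) y -> level_at y L -> y ∈ A \/ is_set y /\ subset y L));
    [unfold supported; def|].
  intros y IH L Hy HL; destruct (classic (ur y)) as [u|hy].
  - left; destruct Hy as (t & _ & Hy & K); auto.
  - right; split; [exact hy|]; intros z Hz; apply (level_at_spec HL).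
    destruct (level_at_exists z) as (d & Hd).
    destruct (IH z Hz d) as [K|(hz & K)]; auto; [eapply supported_mem; eauto|].
    right; split; [exact hz|]; exists z, d; auto.
Qed.

Lemma supported_in_level y : supported (fun u => u ∈ A) y ->
  exists L, level L /\ y ∈ L.
Proof.
  intro Hy; destruct (singleton hM y) as (s & hs & Hs).
  destruct (level_at_exists s) as (L & HL), (level_at_exists y) as (d & Hd).
  exists L; split; [exists s; exact HL|]; apply (level_at_spec HL).
  destruct (supported_level_at Hy Hd) as [K|(hy & K)]; [auto|right].
  split; [exact hy|]; exists y, d; rewrite Hs; auto.
Qed.

Lemma level_supported L : level L -> supported (fun u => u ∈ A) L.
Proof.
  intro HL; pose proof (level_is_set HL) as hL.
  destruct (adjoin hM L hL) as (t & ht & Ht); exists t; split; [split; [exact ht|]|split].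
  - intros x y Hx Hy; apply Ht; left; apply Ht in Hx as [Hx| ->]; [|exact Hy].
    destruct (level_transitive HL) as [_ T]; eapply T; eauto.
  - apply Ht; auto.
  - intros u Hu Uu; apply Ht in Hu as [Hu| ->]; [|destruct (hL Uu)].
    destruct HL as (x & HL); apply (level_at_spec HL) in Hu as [Hu|[hu _]];
      [exact Hu|destruct (hu Uu)].
Qed.

(** The level indexed by [s] itself works: a level [L'] is included in the level of index [L'],
    which is a member of the level of index [s] when [L' ∈ s]. *)
Lemma level_sup s : is_set s -> exists L, level L /\
  forall L', L' ∈ s -> level L' -> subset L' L.
Proof.
  intro hs; destruct (level_at_exists s) as (L & HL).
  exists L; split; [exists s; exact HL|]; intros L' HL's HL'.
  destruct (level_at_exists L') as (d & Hd).
  destruct (supported_level_at (level_supported HL') Hd) as [K|(_ & K)].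
  - destruct (level_is_set HL'); apply hA, K.
  - intros z Hz; pose proof (level_at_mem HL Hd HL's) as H.
    destruct (level_at_transitive HL) as [_ T]; apply (T d z H), K, Hz.
Qed.

End Levels.

(** * Reflection for a class *)

(** Takes the place of function extensionality for predicates on environments. *)
Lemma Def_agree (M : structure) (P : (nat -> M) -> Prop) :
  Def P -> forall e e', (forall i, e i = e' i) -> P e -> P e'.
Proof.
  intros (phi & tau & H) e e' E; rewrite (H e), (H e'); apply sat_ext.
  intro i; destruct (tau i); simpl; auto.
Qed.

Lemma Def_sat_class (M : structure) (W : M -> Prop) :
  Def (fun e => W (e 0)) -> forall (p : form) (t : nat -> (nat -> M) -> M),
  (forall i, Term (t i)) -> Def (fun e => sat_class W (fun i => t i e) p).
Proof.
  intros DW p.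
  enough (D : Def (fun e => sat_class W e p)) by (intros t Ht; apply (Def_subst Ht D)).
  assert (Up : forall q (e : nat -> M), sat_class W (scons (e 0) (fun i => e (S i))) q
    <-> sat_class W e q)
    by (intros q e; apply sat_class_agree; intros [|i]; reflexivity).
  induction p as [i j|i j|i|p IH|p IHp q IHq|p IHp q IHq|p IHp q IHq|p IH|p IH];
    simpl; try (def; fail).
  - apply Def_not, IH.
  - apply Def_and; assumption.
  - apply Def_or; assumption.
  - apply Def_imp; assumption.
  - apply (Def_all (Q := fun x e => W x -> sat_class W (scons x e) p)).
    apply Def_imp; [exact DW|]; eapply Def_iff; [|exact IH].
    intro e; symmetry; apply Up.
  - apply (Def_ex (Q := fun x e => W x /\ sat_class W (scons x e) p)).
    apply Def_and; [exact DW|]; eapply Def_iff; [|exact IH].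
    intro e; symmetry; apply Up.
Qed.

(** Deliberately crude: binders do not lower it, so that one [k] above the bound of a formula is
    also above that of all its subformulas. *)
Fixpoint bound (p : form) : nat :=
  match p with
  | Eq i j | Mem i j => S (i + j)
  | Ur i => S i
  | Neg p | All p | Ex p => bound p
  | And p q | Or p q | Imp p q => bound p + bound q
  end.

Lemma free_bound (p : form) : forall i, free i p -> i < bound p.
Proof.
  induction p as [j k|j k|j|p IH|p IHp q IHq|p IHp q IHq|p IHp q IHq|p IH|p IH];
    simpl; intros i H; try lia; auto.
  - destruct H as [H|H]; [apply IHp in H|apply IHq in H]; lia.
  - destruct H as [H|H]; [apply IHp in H|apply IHq in H]; lia.
  - destruct H as [H|H]; [apply IHp in H|apply IHq in H]; lia.
  - apply IH in H; lia.
  - apply IH in H; lia.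
Qed.

Section Reflection.

Context (M : structure) (hM : ZFUR M) (A : M) (hA : set_of_urelements A).
Context (W : M -> Prop) (DW : Def (fun e => W (e 0))).
Context (W_supported : forall y, W y -> supported (fun u => mem u A) y).
Context (W_transitive : forall x y, W x -> mem y x -> W y).

Local Notation "x ∈ y" := (mem x y) (at level 70, no associativity).
Local Notation level := (level A).

Hint Resolve Def_level Def_level_at : def.

(** [Q L L' e] is to be read as: [L'] contains the witnesses required by the
    environments [e] over [L]. *)
Definition bounded (Q : M -> M -> (nat -> M) -> Prop) : Prop :=
  Def (fun e => Q (e 0) (e 1) (fun i => e (S (S i)))) /\
  (forall L L' L'' e, subset L' L'' -> Q L L' e -> Q L L'' e) /\
  (forall L e, exists L', level L' /\ Q L L' e).

Definition update (n : nat) (x : M) (e : nat -> M) (i : nat) : M :=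
  if Nat.eqb i n then x else e i.

Lemma level_exists : exists L, level L.
Proof.
  destruct (level_at_exists hM hA A) as (L & HL); exists L, A; exact HL.
Qed.

Lemma level_join L L' : level L -> level L' ->
  exists L'', level L'' /\ subset L L'' /\ subset L' L''.
Proof.
  intros HL HL'; destruct (level_total hM hA HL HL') as [K|K].
  - exists L'; split; [exact HL'|split; [exact K|intros z Hz; exact Hz]].
  - exists L; split; [exact HL|split; [intros z Hz; exact Hz|exact K]].
Qed.

Lemma bounded_and Q Q' : bounded Q -> bounded Q' ->
  bounded (fun L L' e => Q L L' e /\ Q' L L' e).
Proof.
  intros (D & Mo & Ex) (D' & Mo' & Ex'); split; [|split].
  - apply Def_and; assumption.
  - intros L L' L'' e H []; split; eauto.
  - intros L e; destruct (Ex L e) as (L1 & H1 & K1), (Ex' L e) as (L2 & H2 & K2).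
    destruct (level_join H1 H2) as (L3 & H3 & I1 & I2).
    exists L3; split; [exact H3|split; eauto].
Qed.

(** For each [x] in [L] and [W] there is a least level that works. Replacement collects these levels
    into a set, and [level_sup] bounds them by a single level. *)
Lemma bounded_all Q n : bounded Q ->
  bounded (fun L L' e => forall x, x ∈ L -> W x -> Q L L' (update n x e)).
Proof.
  intros (D & Mo & Ex); split; [|split].
  - apply (Def_all (Q := fun x e => x ∈ e 0 -> W x ->
      Q (e 0) (e 1) (update n x (fun i => e (S (S i)))))); cbv beta.
    apply Def_imp; [apply Def_mem; term|apply Def_imp; [exact DW|]].
    apply (Def_subst (P := fun e => Q (e 0) (e 1) (fun i => e (S (S i))))
      (t := fun i e => match i with 0 => e 1 | 1 => e 2
        | S (S i) => update n (e 0) (fun i => e (S (S (S i)))) i end)); [|exact D].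
    intros [|[|i]]; unfold update; try (destruct (Nat.eqb i n)); term.
  - intros L L' L'' e H K x Hx Wx; eauto.
  - intros L e; destruct (classic (is_set L)) as [hL|hL].
    + pose (R x L' := level L' /\ (Q L L' (update n x e) /\
        forall L'', level L'' -> Q L L'' (update n x e) -> subset L' L'')).
      assert (DQ : Def (fun e' => Q L (e' 1) (update n (e' 0) e))).
      { apply (Def_subst (P := fun e => Q (e 0) (e 1) (fun i => e (S (S i))))
          (t := fun i e' => match i with 0 => L | 1 => e' 1
            | S (S i) => update n (e' 0) e i end)); [|exact D].
        intros [|[|i]]; unfold update; try (destruct (Nat.eqb i n)); term. }
      pose (Q' x L' := Q L L' (update n x e)).
      change (Def (fun e' => Q' (e' 0) (e' 1))) in DQ.
      destruct (@separation _ hM W L) as (w & hw & Hw); [exact DW|exact hL|].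
      destruct (@replacement _ hM R w) as (v & hv & Hv); [|exact hw| |].
      * unfold R; change (Def (fun e => level (e 1) /\ Q' (e 0) (e 1) /\
          forall L'', level L'' -> Q' (e 0) L'' -> subset (e 1) L'')); def.
      * intros x y y' _ (Hy & Qy & Ly) (Hy' & Qy' & Ly').
        apply (ext hM); try (eapply level_is_set; eauto).
        intro z; split; [apply Ly|apply Ly']; auto.
      * destruct (level_sup hM hA hv) as (L' & HL' & Sup).
        exists L'; split; [exact HL'|]; intros x Hx Wx.
        destruct (Ex L (update n x e)) as (L1 & HL1 & K1).
        destruct (least_level hM hA (P := fun L' => Q' x L') (L0 := L1))
          as (L2 & HL2 & K2 & Least); [def|exact HL1|exact K1|].
        apply Mo with L2; [|exact K2]; apply Sup; [|exact HL2].
        apply Hv; exists x; split; [apply Hw; auto|split; [exact HL2|split]]; auto.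
    + destruct level_exists as (L' & HL'); exists L'; split; [exact HL'|].
      intros x Hx; destruct hL; apply (mem_is_set hM Hx).
Qed.

(** An environment is an infinite sequence and not an element of [M], so only finitely many of its
    entries can be quantified: those below [n], one at a time, the rest staying as in [e]. *)
Fixpoint block (n : nat) (Q : M -> M -> (nat -> M) -> Prop)
  : M -> M -> (nat -> M) -> Prop :=
  match n with
  | 0 => Q
  | S n => fun L L' e => forall x, x ∈ L -> W x -> block n Q L L' (update n x e)
  end.

Lemma bounded_block Q n : bounded Q -> bounded (block n Q).
Proof. intro H; induction n; [exact H|apply bounded_all, IHn]. Qed.

Lemma block_spec Q n L L' : bounded Q -> forall e, block n Q L L' e ->
  forall rho, (forall i, i < n -> rho i ∈ L /\ W (rho i)) ->
  (forall i, n <= i -> rho i = e i) -> Q L L' rho.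
Proof.
  intros (D & _); induction n as [|n IH]; intros e He rho H1 H2; simpl in He.
  - apply (Def_agree D (e := scons L (scons L' e)) (e' := scons L (scons L' rho)));
      [|exact He].
    intros [|[|i]]; simpl; try reflexivity; symmetry; apply H2; lia.
  - destruct (H1 n) as [Hn Wn]; [lia|].
    apply (IH (update n (rho n) e)); auto.
    intros i Hi; unfold update; destruct (Nat.eqb_spec i n) as [->|Ne]; [reflexivity|].
    apply H2; lia.
Qed.

Definition witness (p : form) (L L' : M) (e : nat -> M) : Prop :=
  (exists y, W y /\ sat_class W (scons y e) p) ->
  exists y, y ∈ L' /\ W y /\ sat_class W (scons y e) p.

Lemma bounded_witness p : bounded (witness p).
Proof.
  assert (DS : Def (fun e => sat_class W (scons (e 0) (fun i => e (S (S (S i))))) p)).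
  { eapply Def_iff; [|apply (Def_sat_class DW p (t := fun i e => match i with
      0 => e 0 | S i => e (S (S (S i))) end)); intros [|i]; term].
    intro e; apply sat_class_agree; intros [|i]; reflexivity. }
  split; [|split].
  - apply Def_imp.
    + apply (Def_ex (Q := fun y e => W y /\
        sat_class W (scons y (fun i => e (S (S i)))) p)).
      apply Def_and; [exact DW|exact DS].
    + apply (Def_ex (Q := fun y e => y ∈ e 1 /\ W y /\
        sat_class W (scons y (fun i => e (S (S i)))) p)).
      apply Def_and; [apply Def_mem; term|apply Def_and; [exact DW|exact DS]].
  - intros L L' L'' e H K E; destruct (K E) as (y & Hy & Hy'); exists y; auto.
  - intros L e; destruct (classic (exists y, W y /\ sat_class W (scons y e) p))
      as [(y & Wy & Hy)|N].
    + destruct (supported_in_level hM hA (W_supported Wy)) as (L' & HL' & HyL').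
      exists L'; split; [exact HL'|]; intros _; eauto.
    + destruct level_exists as (L' & HL'); exists L'; split; [exact HL'|].
      intro; contradiction.
Qed.

(** Closure conditions of the Tarski-Vaught test; a universal quantifier asks for counterexamples,
    hence [Neg p]. *)
Fixpoint tarski_vaught (p : form) (L L' : M) (e : nat -> M) : Prop :=
  match p with
  | Eq _ _ | Mem _ _ | Ur _ => True
  | Neg p => tarski_vaught p L L' e
  | And p q | Or p q | Imp p q => tarski_vaught p L L' e /\ tarski_vaught q L L' e
  | All p => tarski_vaught p L L' e /\ witness (Neg p) L L' e
  | Ex p => tarski_vaught p L L' e /\ witness p L L' e
  end.

Lemma bounded_tarski_vaught p : bounded (tarski_vaught p).
Proof.
  assert (T : bounded (fun _ _ _ => True)).
  { split; [apply Def_prop|split; [auto|]]; intros L e.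
    destruct level_exists as (L' & HL'); eauto. }
  induction p; simpl; auto; apply bounded_and; auto; apply bounded_witness.
Qed.

(** The closure hypothesis concerns only environments with values in [t] that equal [w0] from [k]
    on, because those are what [block] can reach. The conclusion leaves the values at non-free
    variables arbitrary. *)
Lemma tarski_vaught_reflects (t w0 : M) (k : nat) (p : form) :
  (forall x, x ∈ t -> W x) -> w0 ∈ t -> bound p <= k ->
  (forall rho, (forall i, i < k -> rho i ∈ t) -> (forall i, k <= i -> rho i = w0) ->
    exists L L', (forall y, y ∈ L' -> W y -> y ∈ t) /\ tarski_vaught p L L' rho) ->
  forall rho, (forall i, free i p -> rho i ∈ t) ->
  (sat_class W rho p <-> sat_class (fun x => x ∈ t) rho p).
Proof.
  intros tW Hw0.
  assert (Wit : forall p q rho, bound p <= k ->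
    (forall i, free i (Ex p) -> rho i ∈ t) ->
    (forall rho, (forall i, i < k -> rho i ∈ t) -> (forall i, k <= i -> rho i = w0) ->
      exists L L', (forall y, y ∈ L' -> W y -> y ∈ t) /\
        tarski_vaught q L L' rho /\ witness p L L' rho) ->
    (exists y, W y /\ sat_class W (scons y rho) p) ->
    exists y, y ∈ t /\ sat_class W (scons y rho) p).
  { intros q r rho Hk Hrho TV (y & Wy & Hy).
    (* Resetting the non-free variables to [w0] makes the closure hypothesis applicable without
       affecting truth. *)
    pose (rho' i := if excluded_middle_informative (free i (Ex q)) then rho i else w0).
    assert (Ag : forall z, sat_class W (scons z rho) q <-> sat_class W (scons z rho') q).
    { intro z; apply sat_class_agree; intros [|i] Hi; [reflexivity|]; simpl.
      unfold rho'; destruct (excluded_middle_informative _) as [_|N]; [reflexivity|].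
      destruct (N Hi). }
    destruct (TV rho') as (L & L' & HL' & _ & HW).
    - intros i _; unfold rho'; destruct (excluded_middle_informative _); auto.
    - intros i Hi; unfold rho'; destruct (excluded_middle_informative _) as [F|_]; auto.
      apply free_bound in F; simpl in F; lia.
    - destruct HW as (z & Hz & Wz & Sz); [exists y; split; [exact Wy|apply Ag, Hy]|].
      exists z; split; [auto|apply Ag, Sz]. }
  assert (Sub : forall (P Q : M -> M -> (nat -> M) -> Prop),
    (forall L L' e, P L L' e -> Q L L' e) ->
    (forall rho, (forall i, i < k -> rho i ∈ t) -> (forall i, k <= i -> rho i = w0) ->
      exists L L', (forall y, y ∈ L' -> W y -> y ∈ t) /\ P L L' rho) ->
    (forall rho, (forall i, i < k -> rho i ∈ t) -> (forall i, k <= i -> rho i = w0) ->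
      exists L L', (forall y, y ∈ L' -> W y -> y ∈ t) /\ Q L L' rho)).
  { intros P Q I H rho H1 H2; destruct (H rho H1 H2) as (L & L' & K & K').
    exists L, L'; auto. }
  assert (Left : forall P Q : M -> M -> (nat -> M) -> Prop,
    forall L L' e, P L L' e /\ Q L L' e -> P L L' e) by tauto.
  assert (Right : forall P Q : M -> M -> (nat -> M) -> Prop,
    forall L L' e, P L L' e /\ Q L L' e -> Q L L' e) by tauto.
  induction p as [i j|i j|i|p IH|p IHp q IHq|p IHp q IHq|p IHp q IHq|p IH|p IH];
    simpl; intros Hk TV rho Hrho; try tauto.
  - rewrite IH; auto; tauto.
  - rewrite IHp, IHq; auto; try lia; try tauto.
    + eapply Sub; [|exact TV]; apply Right.
    + eapply Sub; [|exact TV]; apply Left.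
  - rewrite IHp, IHq; auto; try lia; try tauto.
    + eapply Sub; [|exact TV]; apply Right.
    + eapply Sub; [|exact TV]; apply Left.
  - rewrite IHp, IHq; auto; try lia; try tauto.
    + eapply Sub; [|exact TV]; apply Right.
    + eapply Sub; [|exact TV]; apply Left.
  - assert (E : forall x, x ∈ t -> (sat_class W (scons x rho) p <->
      sat_class (fun x => x ∈ t) (scons x rho) p)).
    { intros x Hx; apply IH; [exact Hk| |intros [|i] Hi; simpl; auto].
      eapply Sub; [|exact TV]; apply Left. }
    split; intros H x Hx; [apply E; auto|].
    apply NNPP; intro N; destruct (Wit (Neg p) p rho) as (y & Hy & Ny); auto.
    + exists x; auto.
    + apply Ny, E; auto.
  - assert (E : forall x, x ∈ t -> (sat_class W (scons x rho) p <->
      sat_class (fun x => x ∈ t) (scons x rho) p)).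
    { intros x Hx; apply IH; [exact Hk| |intros [|i] Hi; simpl; auto].
      eapply Sub; [|exact TV]; apply Left. }
    split; intros H.
    + destruct (Wit p p rho) as (y & Hy & Sy); auto; exists y; split; [|apply E]; auto.
    + destruct H as (y & Hy & Sy); exists y; split; [|apply E]; auto.
Qed.

Lemma common_level (v L0 : M) (n : nat) (rho : nat -> M) :
  L0 ∈ v -> level L0 ->
  (forall i, i < n -> exists L, L ∈ v /\ level L /\ rho i ∈ L) ->
  exists L, L ∈ v /\ level L /\ forall i, i < n -> rho i ∈ L.
Proof.
  intros H0 HL0; induction n as [|n IH]; intro H.
  - exists L0; repeat split; auto; intros i Hi; lia.
  - destruct IH as (L & HLv & HL & K); [auto|].
    destruct (H n) as (L' & HLv' & HL' & K'); [lia|].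
    assert (Split : forall i, i < S n -> i < n \/ i = n) by lia.
    destruct (level_total hM hA HL HL') as [I|I].
    + exists L'; repeat split; auto.
      intros i Hi; destruct (Split i Hi) as [Hi'| ->]; auto.
    + exists L; repeat split; auto.
      intros i Hi; destruct (Split i Hi) as [Hi'| ->]; auto.
Qed.

Lemma class_reflection (p : form) (x w0 : M) :
  supported (fun u => u ∈ A) x -> W w0 ->
  exists t, transitive_set t /\ (forall y, y ∈ x -> W y -> y ∈ t) /\
  (forall y, y ∈ t -> W y) /\ forall rho, (forall i, free i p -> rho i ∈ t) ->
  (sat_class W rho p <-> sat_class (fun x => x ∈ t) rho p).
Proof.
  intros Sx Ww0.
  destruct (supported_in_level hM hA Sx) as (L1 & HL1 & HxL1).
  destruct (supported_in_level hM hA (W_supported Ww0)) as (L2 & HL2 & HwL2).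
  destruct (level_join HL1 HL2) as (L0 & HL0 & I1 & I2).
  apply I1 in HxL1; apply I2 in HwL2; clear L1 L2 HL1 HL2 I1 I2.
  set (k := bound p).
  pose proof (bounded_block k (bounded_tarski_vaught p)) as BQ.
  set (Q := block k (tarski_vaught p)) in BQ.
  pose (Q0 L L' := subset L L' /\ Q L L' (fun _ => w0)).
  assert (DQ : Def (fun e => Q0 (e 0) (e 1))).
  { unfold Q0; apply Def_and; [def|].
    apply (Def_subst (P := fun e => Q (e 0) (e 1) (fun i => e (S (S i))))
      (t := fun i e => match i with 0 => e 0 | 1 => e 1 | _ => w0 end)); [|apply BQ].
    intros [|[|i]]; term. }
  (* The least next level, for uniqueness; non-levels are fixed points because [closed_set] iterates
     a total function. *)
  pose (G L L' := level L /\ level L' /\ Q0 L L' /\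
    (forall L'', level L'' -> Q0 L L'' -> subset L' L'') \/ ~ level L /\ L' = L).
  destruct (@closed_set _ hM G L0) as (v & hv & Hv & Cv).
  - unfold G; def.
  - intro L; destruct (classic (level L)) as [HL|HL].
    + destruct BQ as (_ & Mo & Ex); destruct (Ex L (fun _ => w0)) as (L1 & HL1 & K1).
      destruct (level_join HL HL1) as (L2 & HL2 & I & I1).
      destruct (least_level hM hA (P := fun L' => Q0 L L') (L0 := L2))
        as (L3 & HL3 & K3 & Least); [def|exact HL2|split; eauto|].
      exists L3; split; [left; auto|].
      intros L' [(_ & HL' & K' & Least')|[N _]]; [|contradiction].
      apply (ext hM); try (eapply level_is_set; eauto).
      intro z; split; [apply Least|apply Least']; auto.
    + exists L; split; [right; auto|].
      intros L' [(N & _)|[_ ->]]; [contradiction|reflexivity].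
  - destruct (zfu_union hM hv) as (u & hu & Hu).
    (* Nothing says that [v] consists of levels, so [t] is built only from those members of [v] that
       are. *)
    destruct (@separation _ hM (fun y => W y /\ exists L, L ∈ v /\ level L /\ y ∈ L) u)
      as (t & ht & Ht); [def|exact hu|].
    assert (Ht' : forall y, y ∈ t <-> W y /\ exists L, L ∈ v /\ level L /\ y ∈ L).
    { intro y; rewrite Ht; split; [tauto|]; intros (Wy & L & HL & HL' & Hy).
      split; [apply Hu; eauto|eauto 6]. }
    exists t; split; [split; [exact ht|]|split; [|split]].
    + intros y z Hy Hz; apply Ht' in Hy as (Wy & L & HL & HL' & Hy); apply Ht'.
      split; [eapply W_transitive; eauto|]; exists L; repeat split; auto.
      destruct (level_transitive hM hA HL') as [_ T]; eapply T; eauto.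
    + intros y Hy Wy; apply Ht'; split; [exact Wy|]; exists L0; repeat split; auto.
      destruct (level_transitive hM hA HL0) as [_ T]; exact (T x y HxL1 Hy).
    + intros y Hy; apply Ht' in Hy; tauto.
    + apply tarski_vaught_reflects with w0 k; [|apply Ht'; eauto 6|apply le_n|].
      * intros y Hy; apply Ht' in Hy; tauto.
      * intros rho H1 H2.
        destruct (@common_level v L0 k rho) as (L & HLv & HL & K); auto.
        { intros i Hi; apply Ht', H1, Hi. }
        destruct BQ as (_ & Mo & Ex); destruct (Ex L (fun _ => w0)) as (L1 & HL1 & K1).
        destruct (level_join HL HL1) as (L2 & HL2 & I & I1).
        destruct (least_level hM hA (P := fun L' => Q0 L L') (L0 := L2))
          as (L3 & HL3 & K3 & Least); [def|exact HL2|split; eauto|].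
        (* [L] holds the values of [rho] below [k]; its successor under [G], again in [v], holds the
           witnesses. *)
        assert (HL3v : L3 ∈ v) by (apply (Cv L L3 HLv); left; auto).
        exists L, L3; split.
        -- intros y Hy Wy; apply Ht'; eauto 6.
        -- destruct K3 as [_ K3].
           apply (block_spec (bounded_tarski_vaught p) K3); [|exact H2].
           intros i Hi; split; [auto|]; apply Ht', H1, Hi.
Qed.

End Reflection.

(** * Comparison of well-orders and copies of sets of urelements *)

Section Injections.

Context (M : structure) (hM : ZFUR M).

Local Notation "x ∈ y" := (mem x y) (at level 70, no associativity).

Definition inj (f X Y : M) : Prop :=
  (forall a b, related f a b -> a ∈ X /\ b ∈ Y) /\
  (forall a, a ∈ X -> exists b, related f a b) /\
  (forall a b b', related f a b -> related f a b' -> b = b') /\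
  (forall a a' b, related f a b -> related f a' b -> a = a').

Lemma injects_inj (X Y : M) : injects X Y -> exists f, inj f X Y.
Proof. intros (f & Hf); exists f; apply (injection_spec Hf). Qed.

Lemma class_injection (P : M -> M -> Prop) (X Y : M) :
  Def (fun e => P (e 0) (e 1)) -> is_set X -> is_set Y ->
  (forall a, a ∈ X -> exists b, b ∈ Y /\ P a b) ->
  (forall a b b', a ∈ X -> P a b -> P a b' -> b = b') ->
  (forall a a' b, a ∈ X -> a' ∈ X -> P a b -> P a' b -> a = a') ->
  exists f, inj f X Y /\ forall a b, related f a b <-> a ∈ X /\ b ∈ Y /\ P a b.
Proof.
  intros D hX hY T F I.
  destruct (relation_comprehension hM D hX hY) as (f & _ & Hf).
  exists f; split; [|exact Hf]; split; [|split; [|split]].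
  - intros a b K; apply Hf in K; tauto.
  - intros a Ha; destruct (T a Ha) as (b & Hb & K); exists b; apply Hf; auto.
  - intros a b b' K K'; apply Hf in K as (? & ? & ?), K' as (? & ? & ?); eauto.
  - intros a a' b K K'; apply Hf in K as (? & ? & ?), K' as (? & ? & ?); eauto.
Qed.

Lemma inj_injects (f X Y : M) : is_set X -> is_set Y -> inj f X Y -> injects X Y.
Proof.
  intros hX hY (H1 & H2 & H3 & H4).
  destruct (relation_comprehension hM (P := fun a b => related f a b) (X := X) (Y := Y))
    as (g & Rg & Hg); [def|exact hX|exact hY|].
  exists g; split; [split; [exact Rg|]|].
  - intros a Ha; destruct (H2 a Ha) as (b & Hb); exists b; split.
    + apply Hg; destruct (H1 _ _ Hb); auto.
    + intros b' Hb'; apply Hg in Hb' as (_ & _ & Hb'); eauto.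
  - intros a a' b K K'; apply Hg in K as (_ & _ & K), K' as (_ & _ & K'); eauto.
Qed.

Lemma bij_inj (f X Y : M) : bij f X Y -> inj f X Y.
Proof. unfold bij, inj; tauto. Qed.

Lemma bij_inverse (f X Y : M) : is_set X -> is_set Y -> bij f X Y ->
  exists g, bij g Y X /\ forall a b, related g a b <-> related f b a.
Proof.
  intros hX hY (H1 & H2 & H3 & H4 & H5).
  destruct (relation_comprehension hM (P := fun a b => related f b a) (X := Y) (Y := X))
    as (g & _ & Hg); [def|exact hY|exact hX|].
  assert (E : forall a b, related g a b <-> related f b a).
  { intros a b; rewrite Hg; split; [tauto|]; intro K; destruct (H1 _ _ K); auto. }
  exists g; split; [|exact E]; split; [|split; [|split; [|split]]].
  - intros a b K; apply E in K; destruct (H1 _ _ K); auto.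
  - intros a Ha; destruct (H3 a Ha) as (b & Hb); exists b; apply E, Hb.
  - intros a Ha; destruct (H2 a Ha) as (b & Hb); exists b; apply E, Hb.
  - intros a b b' K K'; apply E in K, K'; eauto.
  - intros a b b' K K'; apply E in K, K'; eauto.
Qed.

Lemma inj_compose (f g X Y Z : M) : is_set X -> is_set Z -> inj f X Y -> inj g Y Z ->
  exists h, inj h X Z /\
    forall a c, related h a c <-> exists b, related f a b /\ related g b c.
Proof.
  intros hX hZ (F1 & F2 & F3 & F4) (G1 & G2 & G3 & G4).
  destruct (@class_injection (fun a c => exists b, related f a b /\ related g b c) X Z)
    as (h & Hh & E); auto; [def|..].
  - intros a Ha; destruct (F2 a Ha) as (b & Hb), (G2 b) as (c & Hc);
      [eapply F1; eauto|]; exists c; split; [eapply G1; eauto|eauto].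
  - intros a c c' _ (b & Hb & Hc) (b' & Hb' & Hc').
    rewrite (F3 a b b' Hb Hb') in Hc; eauto.
  - intros a a' c _ _ (b & Hb & Hc) (b' & Hb' & Hc').
    rewrite (G4 b b' c Hc Hc') in Hb; eauto.
  - exists h; split; [exact Hh|]; intros a c; rewrite E; split; [tauto|].
    intros (b & Hb & Hc); destruct (F1 _ _ Hb), (G1 _ _ Hc); eauto 6.
Qed.

Lemma injects_trans (X Y Z : M) : is_set X -> is_set Z ->
  injects X Y -> injects Y Z -> injects X Z.
Proof.
  intros hX hZ H H'; destruct (injects_inj H) as (f & Hf), (injects_inj H') as (g & Hg).
  destruct (inj_compose hX hZ Hf Hg) as (h & Hh & _); eapply inj_injects; eauto.
Qed.

Lemma subset_injects (X Y : M) : is_set X -> is_set Y -> subset X Y -> injects X Y.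
Proof.
  intros hX hY S; destruct (@class_injection (fun a b => a = b) X Y) as (f & Hf & _);
    auto; [def|..].
  - intros a Ha; eauto.
  - intros; congruence.
  - intros; congruence.
  - eapply inj_injects; eauto.
Qed.

Lemma inj_image (f X Y : M) : is_set Y -> inj f X Y ->
  exists D, is_set D /\ subset D Y /\ bij f X D /\
    forall b, b ∈ D <-> exists a, related f a b.
Proof.
  intros hY (F1 & F2 & F3 & F4).
  destruct (@separation _ hM (fun b => exists a, related f a b) Y) as (D & hD & HD);
    [def|exact hY|].
  assert (E : forall b, b ∈ D <-> exists a, related f a b).
  { intro b; rewrite HD; split; [tauto|]; intros (a & Ha); destruct (F1 _ _ Ha); eauto. }
  exists D; split; [exact hD|split; [intros z Hz; apply HD, Hz|split; [|exact E]]].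
  split; [|split; [|split; [|split]]]; auto.
  - intros a b K; split; [apply (F1 _ _ K)|apply E; eauto].
  - intros b Hb; apply E, Hb.
Qed.

Lemma bij_injects (f X Y : M) : is_set X -> is_set Y -> bij f X Y ->
  injects X Y /\ injects Y X.
Proof.
  intros hX hY Hf; split; [eapply inj_injects; eauto; apply bij_inj; exact Hf|].
  destruct (bij_inverse hX hY Hf) as (g & Hg & _).
  eapply inj_injects; eauto; apply bij_inj; exact Hg.
Qed.

Lemma bij_union (p q X Y C D X' Y' : M) : is_set X' -> is_set Y' ->
  (forall z, z ∈ X' <-> z ∈ X \/ z ∈ C) -> (forall z, z ∈ Y' <-> z ∈ Y \/ z ∈ D) ->
  disjoint C X -> disjoint D Y -> bij p X Y -> bij q C D ->
  exists p', bij p' X' Y' /\ forall a b, related p a b -> related p' a b.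
Proof.
  intros hX' hY' EX EY DX DY (P1 & P2 & P3 & P4 & P5) (Q1 & Q2 & Q3 & Q4 & Q5).
  destruct (relation_comprehension hM (P := fun a b => related p a b \/ related q a b)
    (X := X') (Y := Y')) as (g & _ & Hg); [def|exact hX'|exact hY'|].
  assert (E : forall a b, related g a b <-> related p a b \/ related q a b).
  { intros a b; rewrite Hg, EX, EY; split; [tauto|].
    intros [K|K]; [destruct (P1 _ _ K)|destruct (Q1 _ _ K)]; auto. }
  exists g; split; [|intros a b K; apply E; auto].
  split; [|split; [|split; [|split]]].
  - intros a b K; apply Hg in K; tauto.
  - intros a Ha; apply EX in Ha as [Ha|Ha];
      [destruct (P2 a Ha) as (b & Hb)|destruct (Q2 a Ha) as (b & Hb)];
      exists b; apply E; auto.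
  - intros b Hb; apply EY in Hb as [Hb|Hb];
      [destruct (P3 b Hb) as (a & Ha)|destruct (Q3 b Hb) as (a & Ha)];
      exists a; apply E; auto.
  - intros a b b' K K'; apply E in K as [K|K]; apply E in K' as [K'|K']; eauto;
      destruct (P1 _ _ ltac:(eassumption)), (Q1 _ _ ltac:(eassumption));
      destruct (DX a); auto.
  - intros a a' b K K'; apply E in K as [K|K]; apply E in K' as [K'|K']; eauto;
      destruct (P1 _ _ ltac:(eassumption)), (Q1 _ _ ltac:(eassumption));
      destruct (DY b); auto.
Qed.

End Injections.

(** * Comparability of the subsets of a well-ordered set *)

Section Comparison.

Context (M : structure) (hM : ZFUR M) (B r : M) (hB : is_set B)
  (hr : strict_well_order r B).

Local Notation "x ∈ y" := (mem x y) (at level 70, no associativity).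
Local Notation "x ≺ y" := (related r x y) (at level 70, no associativity).

Lemma wo_mem a b : a ≺ b -> a ∈ B /\ b ∈ B.
Proof.
  destruct hr as [(_ & Hr) _]; intros (p & Hp & Hpr).
  destruct (Hr p Hpr) as (c & d & Hc & Hd & Hcd).
  destruct (pair_inj Hp Hcd) as [-> ->]; auto.
Qed.

Lemma wo_irrefl a : ~ a ≺ a.
Proof. apply hr. Qed.

Lemma wo_trans a b c : a ≺ b -> b ≺ c -> a ≺ c.
Proof. apply hr. Qed.

Lemma wo_total a b : a ∈ B -> b ∈ B -> a ≺ b \/ a = b \/ b ≺ a.
Proof. apply hr. Qed.

Lemma wo_least (P : M -> Prop) a : Def (fun e => P (e 0)) -> a ∈ B -> P a ->
  exists m, m ∈ B /\ P m /\ forall b, b ≺ m -> ~ P b.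
Proof.
  intros D Ha Pa; destruct (separation hM D hB) as (Y & hY & HY).
  destruct hr as (_ & _ & _ & _ & W).
  destruct (W Y) as (m & Hm & Min); [intros z Hz; apply HY, Hz|exists a; apply HY; auto|].
  apply HY in Hm as [Hm Pm]; exists m; split; [exact Hm|split; [exact Pm|]].
  intros b Hb Pb; apply (Min b); [apply HY; split; [apply (wo_mem Hb)|exact Pb]|exact Hb].
Qed.

(** The isomorphism between initial segments of [R] and [S] is the largest
    bisimulation for [≺] between them. *)
Lemma wo_compare R S : is_set R -> is_set S -> subset R B -> subset S B ->
  exists h D E, is_set D /\ is_set E /\ bij h D E /\ subset D R /\ subset E S /\
    (forall b b', b ∈ E -> b' ∈ S -> b' ≺ b -> b' ∈ E) /\ (subset R D \/ subset S E).
Proof.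
  intros hR hS RB SB.
  pose (bisim g := forall a b : M, related g a b -> a ∈ R /\ b ∈ S /\
    (forall a', a' ∈ R -> a' ≺ a -> exists b', b' ≺ b /\ related g a' b') /\
    (forall b', b' ∈ S -> b' ≺ b -> exists a', a' ≺ a /\ related g a' b')).
  pose (sim a b := exists g, is_set g /\ bisim g /\ related g a b).
  assert (Dsim : Def (fun e => sim (e 0) (e 1))) by (unfold sim, bisim; def).
  assert (Un : forall a b, sim a b -> a ∈ R /\ b ∈ S /\
    (forall a', a' ∈ R -> a' ≺ a -> exists b', b' ≺ b /\ sim a' b') /\
    (forall b', b' ∈ S -> b' ≺ b -> exists a', a' ≺ a /\ sim a' b')).
  { intros a b (g & hg & Hg & Hab); destruct (Hg _ _ Hab) as (Ha & Hb & K1 & K2).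
    split; [exact Ha|split; [exact Hb|split]].
    - intros a' Ha' L; destruct (K1 a' Ha' L) as (b' & Hb' & K).
      exists b'; split; [exact Hb'|exists g; auto].
    - intros b' Hb' L; destruct (K2 b' Hb' L) as (a' & Ha' & K).
      exists a'; split; [exact Ha'|exists g; auto]. }
  assert (Fun : forall a b b', sim a b -> sim a b' -> b = b').
  { intros a b b' Hb Hb'; apply NNPP; intro N.
    (* Let [m] be least with two values [c ≺ d]. Descending from [d] to [c] gives [m' ≺ m] matched
       with [c]; descending from [m] to [m'] gives [c' ≺ c] matched with [m'] too, against
       minimality. *)
    destruct (@wo_least (fun a => exists b b', sim a b /\ sim a b' /\ b ≺ b') a)
      as (m & Hm & (c & d & Hc & Hd & Hcd) & Min); [def| | |].
    - apply RB, (Un _ _ Hb).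
    - destruct (@wo_total b b') as [K|[K|K]]; [apply SB, (Un _ _ Hb)|apply SB, (Un _ _ Hb')|..];
        [eauto|contradiction|eauto].
    - destruct (Un _ _ Hc) as (_ & HcS & K1 & _), (Un _ _ Hd) as (_ & _ & _ & K2).
      destruct (K2 c HcS Hcd) as (m' & Hm' & K).
      destruct (K1 m') as (c' & Hc' & K'); [apply (Un _ _ K)|exact Hm'|].
      apply (Min m' Hm'); eauto. }
  assert (Inj : forall a a' b, sim a b -> sim a' b -> a = a').
  { assert (K : forall a a' b, sim a b -> sim a' b -> ~ a ≺ a').
    { intros a a' b H H' L; destruct (Un _ _ H) as (Ha & _), (Un _ _ H') as (_ & _ & K & _).
      destruct (K a Ha L) as (b' & Hb' & K'); rewrite (Fun a b' b K' H) in Hb'.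
      exact (wo_irrefl Hb'). }
    intros a a' b H H'.
    destruct (@wo_total a a') as [L|[L|L]]; auto; [apply RB, (Un _ _ H)|apply RB, (Un _ _ H')|..].
    - destruct (K a a' b H H' L).
    - destruct (K a' a b H' H L). }
  destruct (@separation _ hM (fun a => exists b, sim a b) R) as (D & hD & HD);
    [def|exact hR|].
  destruct (@separation _ hM (fun b => exists a, sim a b) S) as (E & hE & HE);
    [def|exact hS|].
  destruct (relation_comprehension hM Dsim hR hS) as (h & [hh _] & Hh).
  assert (Eh : forall a b, related h a b <-> sim a b).
  { intros a b; rewrite Hh; split; [tauto|]; intro K; destruct (Un _ _ K); tauto. }
  exists h, D, E; split; [exact hD|split; [exact hE|split; [|split; [|split; [|split]]]]].
  - split; [|split; [|split; [|split]]].
    + intros a b K; apply Eh in K; destruct (Un _ _ K) as (? & ? & _).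
      rewrite HD, HE; eauto 6.
    + intros a Ha; apply HD in Ha as (_ & b & Hb); exists b; apply Eh, Hb.
    + intros b Hb; apply HE in Hb as (_ & a & Ha); exists a; apply Eh, Ha.
    + intros a b b' K K'; apply Eh in K, K'; eauto.
    + intros a a' b K K'; apply Eh in K, K'; eauto.
  - intros z Hz; apply HD, Hz.
  - intros z Hz; apply HE, Hz.
  - intros b b' Hb Hb' L; apply HE in Hb as (_ & a & Ha).
    destruct (Un _ _ Ha) as (_ & _ & _ & K); destruct (K b' Hb' L) as (a' & _ & K').
    apply HE; eauto.
  - apply NNPP; intro N; apply not_or_and in N as [N1 N2].
    apply not_all_ex_not in N1 as (a0 & N1), N2 as (b0 & N2).
    apply imply_to_and in N1 as [Ha0 Na0], N2 as [Hb0 Nb0].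
    (* If neither side is exhausted, the least unmatched points correspond to each other: [h] with
       this pair adjoined is still a bisimulation. *)
    destruct (@wo_least (fun a => a ∈ R /\ ~ a ∈ D) a0) as (a & _ & (Ha & Na) & Mina);
      [def|auto|auto|].
    destruct (@wo_least (fun b => b ∈ S /\ ~ b ∈ E) b0) as (b & _ & (Hb & Nb) & Minb);
      [def|auto|auto|].
    destruct (related_adjoin hM a b hh) as (g & hg & Hg).
    apply Na, HD; split; [exact Ha|]; exists b, g; split; [exact hg|split; [|apply Hg; auto]].
    intros c d Hcd; apply Hg in Hcd as [Hcd|[-> ->]].
    + apply Eh in Hcd; destruct (Un _ _ Hcd) as (Hc & Hd & K1 & K2).
      split; [exact Hc|split; [exact Hd|split]].
      * intros a' Ha' L; destruct (K1 a' Ha' L) as (b' & Hb' & K).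
        exists b'; split; [exact Hb'|apply Hg; left; apply Eh, K].
      * intros b' Hb' L; destruct (K2 b' Hb' L) as (a' & Ha' & K).
        exists a'; split; [exact Ha'|apply Hg; left; apply Eh, K].
    + split; [exact Ha|split; [exact Hb|split]].
      * intros a' Ha' L; assert (K : a' ∈ D) by (apply NNPP; intro K; apply (Mina a' L); auto).
        apply HD in K as (_ & b' & K); exists b'; split; [|apply Hg; left; apply Eh, K].
        destruct (Un _ _ K) as (_ & Hb' & _ & K2).
        destruct (@wo_total b' b) as [L'|[L'|L']]; auto; exfalso; apply Nb, HE.
        -- subst b'; eauto.
        -- destruct (K2 b Hb L') as (a'' & _ & K''); eauto.
      * intros b' Hb' L; assert (K : b' ∈ E) by (apply NNPP; intro K; apply (Minb b' L); auto).
        apply HE in K as (_ & a' & K); exists a'; split; [|apply Hg; left; apply Eh, K].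
        destruct (Un _ _ K) as (Ha' & _ & K1 & _).
        destruct (@wo_total a' a) as [L'|[L'|L']]; auto; exfalso; apply Na, HD.
        -- subst a'; eauto.
        -- destruct (K1 a Ha L') as (b'' & _ & K''); eauto.
Qed.

End Comparison.

(** * Copies of sets of urelements outside a given set *)

Section Copies.

Context (M : structure) (hM : ZFUR M).

Local Notation "x ∈ y" := (mem x y) (at level 70, no associativity).

Definition copyable (s X : M) : Prop :=
  exists D, set_of_urelements D /\ disjoint D X /\ injects s D.

Lemma copyable_injects s s' X : is_set s -> injects s s' -> copyable s' X -> copyable s X.
Proof.
  intros hs I (D & HD & K & I'); exists D; split; [exact HD|split; [exact K|]].
  eapply (injects_trans hM); eauto; apply HD.
Qed.

(** [X0] witnesses that [S] is the shortest initial segment of [B] that cannot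
    be copied everywhere. *)
Lemma copyable_outside (B r S X0 C X : M) :
  is_set B -> strict_well_order r B -> is_set S -> subset S B -> ~ copyable S X0 ->
  (forall b s X, b ∈ S -> is_set s -> (forall z, z ∈ s <-> z ∈ S /\ related r z b) ->
    set_of_urelements X -> copyable s X) ->
  injects C B -> set_of_urelements C -> disjoint C X0 -> set_of_urelements X ->
  copyable C X.
Proof.
  intros hB hr hS SB NS Short I HC CX0 HX.
  destruct (injects_inj I) as (f & Hf).
  destruct (inj_image hM hB Hf) as (R & hR & RB & BR & _).
  destruct (bij_injects hM (proj1 HC) hR BR) as [CR RC].
  destruct (wo_compare hM hB hr hR hS RB SB)
    as (h & D & E & hD & hE & BDE & DR & ES & Down & Dich).
  destruct (bij_injects hM hD hE BDE) as [DE ED].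
  destruct (classic (subset S E)) as [SE|SE].
  (* All of [S] is matched, so [S] injects into [C], which is itself disjoint from [X0]. *)
  - destruct NS; exists C; split; [exact HC|split; [exact CX0|]].
    apply (injects_trans hM) with R; [exact hS|apply HC| |exact RC].
    apply (injects_trans hM) with D; [exact hS|exact hR| |apply (subset_injects hM); auto].
    apply (injects_trans hM) with E; auto; apply (subset_injects hM); auto.
  - assert (RD : subset R D) by tauto.
    (* Some [b] in [S] is unmatched, and [E], being downward closed in [S], lies below it. So [C]
       injects into a shorter segment, which can be copied. *)
    apply not_all_ex_not in SE as (b & SE); apply imply_to_and in SE as [Hb Nb].
    destruct (@separation _ hM (fun z => related r z b) S) as (s & hs & Hs);
      [def|exact hS|].
    apply copyable_injects with s; [apply HC| |apply (Short b); auto].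
    apply (injects_trans hM) with R; [apply HC|exact hs|exact CR|].
    apply (injects_trans hM) with D; [exact hR|exact hs|apply (subset_injects hM); auto|].
    apply (injects_trans hM) with E; [exact hD|exact hs|exact DE|].
    apply (subset_injects hM); auto; intros z Hz; apply Hs; split; [auto|].
    destruct (@wo_total _ _ _ hr z b) as [K|[K|K]]; auto; destruct Nb; [subst b; auto|].
    apply (Down z b); auto.
Qed.

Lemma tail_plus_copies : TailPlus M ->
  exists A0, set_of_urelements A0 /\ forall C X, set_of_urelements C ->
    disjoint C A0 -> set_of_urelements X -> copyable C X.
Proof.
  intro TP; destruct (empty_set hM) as (e & he & He).
  assert (Se : set_of_urelements e) by (split; [exact he|intros a Ha; destruct (He a Ha)]).
  destruct (TP e Se) as (B & ((hB & _) & _ & T) & r & hr).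
  assert (T' : forall C, set_of_urelements C -> injects C B)
    by (intros C HC; apply T; [exact HC|intros z [_ Hz]; exact (He z Hz)]).
  pose (bad s := exists X, set_of_urelements X /\ ~ copyable s X).
  pose (bad_at b := exists s, is_set s /\ (forall z, z ∈ s <-> related r z b) /\ bad s).
  assert (Db : Def (fun e => bad_at (e 0))) by (unfold bad_at, bad, copyable; def).
  destruct (classic (exists b, b ∈ B /\ bad_at b)) as [(b0 & Hb0 & Bb0)|N].
  - destruct (wo_least hM hB hr Db Hb0 Bb0)
      as (b & Hb & (S & hS & HS & X0 & HX0 & NX0) & Min).
    exists X0; split; [exact HX0|]; intros C X HC CX0 HX.
    apply copyable_outside with B r S X0; auto.
    + intros z Hz; apply HS in Hz; apply (wo_mem hr Hz).
    + intros c s Y Hc hs Hs HY; apply HS in Hc; apply NNPP; intro NY.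
      apply (Min c Hc); exists s; split; [exact hs|split; [|exists Y; auto]].
      intro z; rewrite Hs, HS; split; [tauto|]; intro K; split; [|exact K].
      eapply wo_trans; eauto.
  (* [B] is not the segment below any of its points, so it is tried separately. If it can be copied
     everywhere, so can every set of urelements, and the empty set serves. *)
  - destruct (classic (bad B)) as [(X0 & HX0 & NX0)|NB].
    + exists X0; split; [exact HX0|]; intros C X HC CX0 HX.
      apply copyable_outside with B r B X0; auto; [intros z Hz; exact Hz|].
      intros c s Y Hc hs Hs HY; apply NNPP; intro NY; apply N.
      exists c; split; [exact Hc|]; exists s; split; [exact hs|split; [|exists Y; auto]].
      intro z; rewrite Hs; split; [tauto|]; intro K; split; [apply (wo_mem hr K)|exact K].
    + exists e; split; [exact Se|]; intros C X HC _ HX.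
      apply copyable_injects with B; [apply HC|apply T', HC|].
      apply NNPP; intro K; apply NB; exists X; auto.
Qed.

End Copies.

(** * Back and forth *)

Section Isomorphisms.

Context (M : structure) (hM : ZFUR M).

Local Notation "x ∈ y" := (mem x y) (at level 70, no associativity).

(** [iso] is the union of all such sets [h], so that it unfolds without any recursion on rank. *)
Definition bisimulation (p h : M) : Prop :=
  forall a b, related h a b ->
    (ur a /\ ur b /\ related p a b) \/
    (is_set a /\ is_set b /\
     (forall c, c ∈ a -> exists d, d ∈ b /\ related h c d) /\
     (forall d, d ∈ b -> exists c, c ∈ a /\ related h c d)).

(** The isomorphism between the hierarchies over [X] and [Y] that extends a
    bijection [p] from [X] to [Y]. *)
Definition iso (p u x : M) : Prop := exists h, is_set h /\ bisimulation p h /\ related h u x.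

Lemma Def_iso : Def (fun e => iso (e 0) (e 1) (e 2)).
Proof. unfold iso, bisimulation; def. Qed.

Hint Resolve Def_iso : def.

Lemma iso_unfold p a b : iso p a b ->
  (ur a /\ ur b /\ related p a b) \/
  (is_set a /\ is_set b /\
   (forall c, c ∈ a -> exists d, d ∈ b /\ iso p c d) /\
   (forall d, d ∈ b -> exists c, c ∈ a /\ iso p c d)).
Proof.
  intros (h & hh & Hh & Hab); destruct (Hh _ _ Hab) as [K|(ha & hb & K1 & K2)];
    [auto|right; split; [exact ha|split; [exact hb|split]]].
  - intros c Hc; destruct (K1 c Hc) as (d & Hd & K); exists d; split; [exact Hd|exists h; auto].
  - intros d Hd; destruct (K2 d Hd) as (c & Hc & K); exists c; split; [exact Hc|exists h; auto].
Qed.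

Lemma iso_mono p q u x : (forall a b, related p a b -> related q a b) ->
  iso p u x -> iso q u x.
Proof.
  intros I (h & hh & Hh & Hab); exists h; split; [exact hh|split; [|exact Hab]].
  intros a b K; destruct (Hh _ _ K) as [(? & ? & ?)|K']; auto.
Qed.

Lemma iso_functional p u x x' :
  (forall a b b', related p a b -> related p a b' -> b = b') ->
  iso p u x -> iso p u x' -> x = x'.
Proof.
  intro F; revert u x x'; apply (mem_induction hM (P := fun u => forall x x',
    iso p u x -> iso p u x' -> x = x')); [def|].
  intros u IH x x' H H'; apply iso_unfold in H as [(Uu & _ & K)|(hu & hx & K1 & K2)];
    apply iso_unfold in H' as [(Uu' & _ & K')|(hu' & hx' & K1' & K2')];
    [eauto|contradiction|contradiction|].
  apply (ext hM); auto; intro z; split; intro Hz.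
  - destruct (K2 z Hz) as (c & Hc & Hcz), (K1' c Hc) as (z' & Hz' & Hcz').
    rewrite (IH c Hc z z'); auto.
  - destruct (K2' z Hz) as (c & Hc & Hcz), (K1 c Hc) as (z' & Hz' & Hcz').
    rewrite (IH c Hc z z'); auto.
Qed.

Lemma iso_injective p u u' x :
  (forall a a' b, related p a b -> related p a' b -> a = a') ->
  iso p u x -> iso p u' x -> u = u'.
Proof.
  intro F; revert x u u'; apply (mem_induction hM (P := fun x => forall u u',
    iso p u x -> iso p u' x -> u = u')); [def|].
  intros x IH u u' H H'; apply iso_unfold in H as [(_ & Ux & K)|(hu & hx & K1 & K2)];
    apply iso_unfold in H' as [(_ & Ux' & K')|(hu' & hx' & K1' & K2')];
    [eauto|contradiction|contradiction|].
  apply (ext hM); auto; intro z; split; intro Hz.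
  - destruct (K1 z Hz) as (c & Hc & Hcz), (K2' c Hc) as (z' & Hz' & Hcz').
    rewrite (IH c Hc z z'); auto.
  - destruct (K1' z Hz) as (c & Hc & Hcz), (K2 c Hc) as (z' & Hz' & Hcz').
    rewrite (IH c Hc z z'); auto.
Qed.

Lemma iso_total p X Y u : set_of_urelements Y -> bij p X Y ->
  supported (fun a => a ∈ X) u -> exists x, iso p u x.
Proof.
  intros [_ HY] (P1 & T & _ & F & _) (t & [ht Ht] & Hu & Kt).
  revert u Hu; apply (mem_induction hM (P := fun u => u ∈ t -> exists x, iso p u x)); [def|].
  intros u IH Hu.
  destruct (@function_comprehension _ hM (fun a b => iso p a b) t) as (h & hh & Hh);
    [def|exact ht|intros; eapply iso_functional; eauto|].
  (* The converse of [iso_unfold] at [u]: [h] is [iso] on the transitive set [t], so it already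
     holds the pairs of members that the new pair requires. *)
  assert (Add : forall x, (ur u /\ ur x /\ related p u x) \/ (is_set u /\ is_set x /\
      (forall c, c ∈ u -> exists d, d ∈ x /\ iso p c d) /\
      (forall d, d ∈ x -> exists c, c ∈ u /\ iso p c d)) -> iso p u x).
  { intros x Hx; destruct (related_adjoin hM u x hh) as (g & hg & Hg).
    exists g; split; [exact hg|split; [|apply Hg; auto]].
    intros a b Hab; apply Hg in Hab.
    assert (E : a ∈ t /\ ((ur a /\ ur b /\ related p a b) \/ (is_set a /\ is_set b /\
      (forall c, c ∈ a -> exists d, d ∈ b /\ iso p c d) /\
      (forall d, d ∈ b -> exists c, c ∈ a /\ iso p c d)))).
    { destruct Hab as [Hab|[-> ->]]; [|auto]; apply Hh in Hab as [Ha Hab].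
      split; [exact Ha|]; apply iso_unfold, Hab. }
    destruct E as (Ha & [E|(ha & hb & K1 & K2)]); [auto|right].
    split; [exact ha|split; [exact hb|split]].
    - intros c Hc; destruct (K1 c Hc) as (d & Hd & K); exists d; split; [exact Hd|].
      apply Hg; left; apply Hh; split; [eapply Ht; eauto|exact K].
    - intros d Hd; destruct (K2 d Hd) as (c & Hc & K); exists c; split; [exact Hc|].
      apply Hg; left; apply Hh; split; [eapply Ht; eauto|exact K]. }
  destruct (classic (ur u)) as [Uu|hu].
  - destruct (T u (Kt u Hu Uu)) as (x & Hx).
    exists x; apply Add; left; split; [exact Uu|split; [|exact Hx]].
    apply HY, (P1 _ _ Hx).
  - destruct (@replacement _ hM (fun a b => iso p a b) u) as (x & hx & Hx);
      [def|exact hu|intros; eapply iso_functional; eauto|].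
    exists x; apply Add; right; split; [exact hu|split; [exact hx|split]].
    + intros c Hc; destruct (IH c Hc) as (d & Hd); [eapply Ht; eauto|].
      exists d; rewrite Hx; eauto.
    + intros d Hd; apply Hx in Hd; exact Hd.
Qed.

Lemma iso_inverse p q u x : (forall a b, related p a b -> related q b a) ->
  iso p u x -> iso q x u.
Proof.
  intros I (h & hh & Hh & Hux).
  destruct (transitive_closure hM u) as (t & [ht Ht] & Hu).
  destruct (transitive_closure hM x) as (s & [hs Hs] & Hx).
  (* Bisimilarity only descends to members, so the converse of [h] may be cut down to the closures
     of [x] and [u]. *)
  destruct (relation_comprehension hM (P := fun b a => related h a b) (X := s) (Y := t))
    as (g & [hg _] & Hg); [def|exact hs|exact ht|].
  exists g; split; [exact hg|split; [|apply Hg; auto]].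
  intros b a K; apply Hg in K as (Hb & Ha & K).
  destruct (Hh _ _ K) as [(Ua & Ub & K')|(ha & hb & K1 & K2)]; [auto|right].
  split; [exact hb|split; [exact ha|split]].
  - intros d Hd; destruct (K2 d Hd) as (c & Hc & Hcd); exists c; split; [exact Hc|].
    apply Hg; eauto.
  - intros c Hc; destruct (K1 c Hc) as (d & Hd & Hcd); exists d; split; [exact Hd|].
    apply Hg; eauto.
Qed.

(** The image under [iso] of a transitive set containing [u] is again transitive, and its urelements
    are values of [p]. *)
Lemma iso_supported p X Y u x : bij p X Y -> iso p u x -> supported (fun a => a ∈ Y) x.
Proof.
  intros (P1 & _ & _ & F & _) Hux.
  destruct (transitive_closure hM u) as (t & [ht Ht] & Hu).
  destruct (@replacement _ hM (fun a b => iso p a b) t) as (s & hs & Hs);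
    [def|exact ht|intros; eapply iso_functional; eauto|].
  exists s; split; [split; [exact hs|]|split].
  - intros b d Hb Hd; apply Hs in Hb as (a & Ha & Hab); apply Hs.
    apply iso_unfold in Hab as [(_ & Ub & _)|(_ & _ & _ & K)].
    + destruct (zfu_urelements hM Ub Hd).
    + destruct (K d Hd) as (c & Hc & Hcd); exists c; split; [eapply Ht; eauto|exact Hcd].
  - apply Hs; eauto.
  - intros b Hb Ub; apply Hs in Hb as (a & Ha & Hab).
    apply iso_unfold in Hab as [(_ & _ & K)|(_ & hb & _)];
      [apply (P1 _ _ K)|destruct (hb Ub)].
Qed.

Lemma iso_refl p X u : (forall a, a ∈ X -> related p a a) ->
  supported (fun a => a ∈ X) u -> iso p u u.
Proof.
  intros I (t & [ht Ht] & Hu & Kt).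
  destruct (@function_comprehension _ hM (fun a b => a = b) t) as (h & hh & Hh);
    [def|exact ht|intros; congruence|].
  exists h; split; [exact hh|split; [|apply Hh; auto]].
  intros a b Hab; apply Hh in Hab as [Ha <-].
  destruct (classic (ur a)) as [Ua|ha]; [left; auto|right].
  split; [exact ha|split; [exact ha|split]];
    intros c Hc; exists c; split; auto; apply Hh; split; auto; eapply Ht; eauto.
Qed.

Lemma supported_weaken (K K' : M -> Prop) u : (forall a, K a -> K' a) ->
  supported K u -> supported K' u.
Proof. intros I (t & Ht & Hu & Kt); exists t; auto. Qed.

End Isomorphisms.

(** * The elementary substructure of sets over [A] and [B] avoiding a room *)

Section Elementarity.

Context (M : structure) (hM : ZFUR M) (A B f0 f1 : M).
Context (hA : set_of_urelements A) (hB : set_of_urelements B) (BA : disjoint B A).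
Context (copies : forall C X, set_of_urelements C -> disjoint C A ->
  set_of_urelements X -> copyable C X).
Context (tail : forall C : M, set_of_urelements C -> disjoint C A -> injects C B).
Context (inj_f0 : inj f0 B B) (inj_f1 : inj f1 B B).
Context (f0_f1 : forall a a' b, related f0 a b -> ~ related f1 a' b).

Local Notation "x ∈ y" := (mem x y) (at level 70, no associativity).

Definition image (T T' : M) : Prop :=
  is_set T' /\ forall z, z ∈ T' <-> exists c, c ∈ T /\ related f1 c z.

(** The rooms are the sets [f1^n(B)]. *)
Definition room (T : M) : Prop :=
  forall K, is_set K -> B ∈ K -> (forall T T', T ∈ K -> image T T' -> T' ∈ K) -> T ∈ K.

Lemma Def_room : Def (fun e => room (e 0)).
Proof. unfold room, image; def. Qed.

Hint Resolve Def_room : def.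

Lemma room_base : room B.
Proof. intros K _ H _; exact H. Qed.

Lemma room_image T T' : room T -> image T T' -> room T'.
Proof. intros H I K hK H0 H1; eapply H1; [apply H|exact I]; auto. Qed.

Lemma image_exists T : is_set T -> exists T', image T T'.
Proof.
  intro hT; apply (replacement hM (P := fun a b => related f1 a b)); [def|exact hT|].
  intros x y y' _; apply inj_f1.
Qed.

(** [room] quantifies only over sets [K], so [P] is cut down to a family of subsets of [B]; this is
    closed under images because [f1] maps into [B]. *)
Lemma room_ind (P : M -> Prop) : Def (fun e => P (e 0)) -> P B ->
  (forall T T', room T -> P T -> image T T' -> P T') -> forall T, room T -> P T.
Proof.
  intros D P0 P1 T HT.
  destruct (zfu_powerset hM (proj1 hB)) as (PB & hPB & HPB).
  destruct (@separation _ hM (fun T => room T /\ P T) PB) as (K & hK & HK);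
    [def|exact hPB|].
  enough (H : T ∈ K) by apply (HK T), H.
  apply HT; [exact hK| |].
  - apply HK; split; [apply HPB; split; [apply hB|intros z Hz; exact Hz]|].
    split; [apply room_base|exact P0].
  - intros S S' HS I; apply HK in HS as (_ & HS & PS); apply HK; split.
    + apply HPB; split; [apply I|].
      intros z Hz; apply I in Hz as (c & _ & Hc); apply (proj1 inj_f1 _ _ Hc).
    + split; [eapply room_image|eapply P1]; eauto.
Qed.

Lemma room_subset T : room T -> is_set T /\ subset T B.
Proof.
  revert T; apply room_ind; [def|split; [apply hB|intros z Hz; exact Hz]|].
  intros T T' _ _ I; split; [apply I|].
  intros z Hz; apply I in Hz as (c & _ & Hc); apply (proj1 inj_f1 _ _ Hc).
Qed.

Lemma image_mono S S' T T' : image S S' -> image T T' -> subset S T -> subset S' T'.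
Proof. intros I J K z Hz; apply I in Hz as (c & Hc & Hz); apply J; eauto. Qed.

Lemma room_decreasing T T' : room T -> image T T' -> subset T' T.
Proof.
  intro HT; revert T HT T'.
  apply (room_ind (P := fun T => forall T', image T T' -> subset T' T)).
  - unfold image; def.
  - intros T' I z Hz; apply I in Hz as (c & _ & Hc); apply (proj1 inj_f1 _ _ Hc).
  - intros T T' _ IH I T'' J; apply (image_mono J I), IH, I.
Qed.

Lemma room_compare S T : room S -> room T -> subset S T \/ subset T S.
Proof.
  intro HS; revert S HS T.
  apply (room_ind (P := fun S => forall T, room T -> subset S T \/ subset T S)); [def|..].
  - intros T HT; right; apply (room_subset HT).
  - intros S S' HS IH I.
    apply (room_ind (P := fun T => subset S' T \/ subset T S')); [def|..].
    + left; apply (room_subset (room_image HS I)).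
    + intros T T' HT _ J; destruct (IH T HT) as [K|K]; [left|right];
        eapply image_mono; eauto.
Qed.

(** For [T = f1^n(B)] the copy is given by [f1^n ∘ f0]; it misses [f1^(n+1)(B)] since [f1] is
    injective and the images of [f0] and [f1] are disjoint. *)
Lemma room_has_copy T T' : room T -> image T T' ->
  exists g, inj g B T /\ forall a b, related g a b -> ~ b ∈ T'.
Proof.
  intro HT; revert T HT T'.
  apply (room_ind (P := fun T => forall T', image T T' ->
    exists g, inj g B T /\ forall a b, related g a b -> ~ b ∈ T')).
  - unfold image, inj; def.
  - intros T' I; exists f0; split; [exact inj_f0|].
    intros a b Hab Hb; apply I in Hb as (c & _ & Hc); exact (f0_f1 Hab Hc).
  - intros T T' HT IH I T'' J; destruct (IH T' I) as (g & Hg & N).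
    destruct inj_f1 as (_ & F2 & F3 & F4), (room_subset HT) as (hT & TB).
    destruct (class_injection hM (P := fun a b => exists c, related g a c /\
      related f1 c b) (X := B) (Y := T')) as (k & Hk & E); [def|apply hB|apply I|..].
    + intros a Ha; destruct Hg as (G1 & G2 & _); destruct (G2 a Ha) as (c & Hc).
      destruct (F2 c) as (b & Hb); [apply TB, (G1 _ _ Hc)|].
      exists b; split; [apply I; exists c; split; [apply (G1 _ _ Hc)|exact Hb]|eauto].
    + intros a b b' _ (c & Hc & Hb) (c' & Hc' & Hb').
      destruct Hg as (_ & _ & G3 & _); rewrite (G3 _ _ _ Hc Hc') in Hb; eauto.
    + intros a a' b _ _ (c & Hc & Hb) (c' & Hc' & Hb').
      destruct Hg as (_ & _ & _ & G4); rewrite (F4 _ _ _ Hb Hb') in Hc; eauto.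
    + exists k; split; [exact Hk|]; intros a b Hab Hb.
      apply E in Hab as (_ & _ & c & Hc & Hcb).
      apply J in Hb as (c' & Hc' & Hcb'); rewrite <- (F4 _ _ _ Hcb Hcb') in Hc'.
      exact (N _ _ Hc Hc').
Qed.

Definition hull (y : M) : Prop :=
  exists T : M, room T /\ supported (fun u => (u ∈ A \/ u ∈ B) /\ ~ u ∈ T) y.

(** The domain [X] is any set of urelements including [A], while [Y] leaves the room [T] free for
    later moves. Including [A] on both sides makes new urelements disjoint from [A], as [tail] and
    [copies] demand. *)
Definition position (p : M) : Prop :=
  exists X Y T : M, set_of_urelements X /\ set_of_urelements Y /\
    subset A X /\ subset A Y /\ (forall u, u ∈ Y -> u ∈ A \/ u ∈ B) /\
    room T /\ disjoint Y T /\ bij p X Y.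

Lemma urelements_outside t X : transitive_set t -> set_of_urelements X -> subset A X ->
  exists C X', set_of_urelements C /\ disjoint C A /\ disjoint C X /\
    (forall z, z ∈ C <-> z ∈ t /\ ur z /\ ~ z ∈ X) /\
    set_of_urelements X' /\ (forall z, z ∈ X' <-> z ∈ X \/ z ∈ C) /\
    (forall u, u ∈ t -> ur u -> u ∈ X').
Proof.
  intros [ht _] [hX HX] AX.
  destruct (@separation _ hM (fun z => ur z /\ ~ z ∈ X) t) as (C & hC & HC);
    [def|exact ht|].
  destruct (binary_union hM hX hC) as (X' & hX' & HX').
  exists C, X'; split; [|split; [|split; [|split; [exact HC|split; [|split; [exact HX'|]]]]]].
  - split; [exact hC|]; intros a Ha; apply HC, Ha.
  - intros z [Hz Hz']; apply HC in Hz as (_ & _ & Hz); auto.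
  - intros z [Hz Hz']; apply HC in Hz as (_ & _ & Hz); auto.
  - split; [exact hX'|]; intros a Ha; apply HX' in Ha as [Ha|Ha]; [auto|apply HC, Ha].
  - intros u Hu Uu; apply HX'; rewrite HC; tauto.
Qed.

(** The urelements below [u] outside [X] go into [B] by [tail], then into [T] outside the next room
    [T']. So their images miss [Y], and [T'] stays free. *)
Lemma forth p u : position p ->
  exists p' x, position p' /\ (forall a b, related p a b -> related p' a b) /\
    iso p' u x /\ hull x.
Proof.
  intros (X & Y & T & HX & HY & AX & AY & YAB & HT & YT & Hp).
  destruct (transitive_closure hM u) as (t & Ht & Hu).
  destruct (urelements_outside Ht HX AX)
    as (C & X' & SC & CA & CX & HC & SX' & HX' & Kt).
  destruct (room_subset HT) as (hT & TB).
  destruct (image_exists hT) as (T' & I).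
  pose proof (room_image HT I) as HT'.
  destruct (room_has_copy HT I) as (g & Hg & Ng).
  destruct (injects_inj (tail SC CA)) as (c & Hc).
  destruct (inj_compose hM (proj1 SC) hT Hc Hg) as (k & Hk & Ek).
  destruct (inj_image hM hT Hk) as (D & hD & DT & BD & HD).
  assert (DY : disjoint D Y) by (intros z [Hz Hz']; apply (YT z); auto).
  destruct (binary_union hM (proj1 HY) hD) as (Y' & hY' & HY').
  destruct (bij_union hM (proj1 SX') hY' HX' HY' CX DY Hp BD) as (p' & Hp' & Ext).
  assert (SY' : set_of_urelements Y').
  { split; [exact hY'|]; intros a Ha; apply HY' in Ha as [Ha|Ha]; [apply HY, Ha|].
    apply hB, TB, DT, Ha. }
  assert (Y'AB : forall a, a ∈ Y' -> (a ∈ A \/ a ∈ B) /\ ~ a ∈ T').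
  { intros a Ha; apply HY' in Ha as [Ha|Ha]; split; auto.
    - intro K; apply (YT a); split; [exact Ha|exact (room_decreasing HT I K)].
    - apply HD in Ha as (b & Hb); apply Ek in Hb as (d & _ & Hd); exact (Ng _ _ Hd). }
  destruct (@iso_total _ hM p' X' Y' u SY' Hp') as (x & Hx); [exists t; auto|].
  exists p', x; split; [|split; [exact Ext|split; [exact Hx|]]].
  - exists X', Y', T'.
    refine (conj SX' (conj SY' (conj _ (conj _ (conj _ (conj HT' (conj _ Hp'))))))).
    + intros z Hz; apply HX'; auto.
    + intros z Hz; apply HY'; auto.
    + intros a Ha; apply Y'AB, Ha.
    + intros a [Ha Ha']; destruct (Y'AB a Ha); auto.
  - exists T'; split; [exact HT'|].
    eapply supported_weaken; [exact Y'AB|]; eapply iso_supported; eauto.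
Qed.

(** The urelements below [x] outside [Y] have a copy outside [X] by [copies], and [p] is extended by
    the inverse of the copying map. *)
Lemma back p x : position p -> hull x ->
  exists p' u, position p' /\ (forall a b, related p a b -> related p' a b) /\ iso p' u x.
Proof.
  intros (X & Y & T & HX & HY & AX & AY & YAB & HT & YT & Hp) (T1 & HT1 & t & Ht & Hx & K).
  destruct (urelements_outside Ht HY AY)
    as (D & Y' & SD & DA & DY & HD & SY' & HY' & Kt).
  destruct (copies SD DA HX) as (C0 & SC0 & C0X & I).
  destruct (injects_inj I) as (q' & Hq').
  destruct (inj_image hM (proj1 SC0) Hq') as (C & hC & CC0 & BC & _).
  destruct (bij_inverse hM (proj1 SD) hC BC) as (q & Hq & _).
  assert (CX : disjoint C X) by (intros z [Hz Hz']; apply (C0X z); auto).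
  destruct (binary_union hM (proj1 HX) hC) as (X' & hX' & HX').
  destruct (bij_union hM hX' (proj1 SY') HX' HY' CX DY Hp Hq) as (p' & Hp' & Ext).
  assert (SX' : set_of_urelements X').
  { split; [exact hX'|]; intros a Ha; apply HX' in Ha as [Ha|Ha]; [apply HX, Ha|].
    apply SC0, CC0, Ha. }
  destruct (bij_inverse hM hX' (proj1 SY') Hp') as (p'' & Hp'' & E).
  destruct (@iso_total _ hM p'' Y' X' x SX' Hp'') as (u & Hu); [exists t; auto|].
  exists p', u; split; [|split; [exact Ext|]].
  (* The smaller of the two rooms is free: old points of [Y'] miss [T], and the new ones, lying
     below [x], miss [T1]. *)
  - assert (R : exists T2, room T2 /\ subset T2 T /\ subset T2 T1).
    { destruct (room_compare HT HT1) as [S|S]; [exists T|exists T1]; repeat split; auto;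
        intros z Hz; exact Hz. }
    destruct R as (T2 & HT2 & S & S1).
    exists X', Y', T2.
    refine (conj SX' (conj SY' (conj _ (conj _ (conj _ (conj HT2 (conj _ Hp'))))))).
    + intros z Hz; apply HX'; auto.
    + intros z Hz; apply HY'; auto.
    + intros a Ha; apply HY' in Ha as [Ha|Ha]; [auto|].
      apply HD in Ha as (Ha & Ua & _); apply (K a Ha Ua).
    + intros a [Ha Ha']; apply HY' in Ha as [Ha|Ha]; [apply (YT a); auto|].
      apply HD in Ha as (Ha & Ua & _); destruct (K a Ha Ua) as [_ N]; auto.
  - eapply iso_inverse; [exact hM| |exact Hu]; intros a b; apply E.
Qed.

(** An Ehrenfeucht-Fraïssé induction: [iso] being injective and functional settles the atoms, and
    [forth] and [back] extend the position at each quantifier. *)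
Lemma hull_elementary (phi : form) : forall (p : M) (rho sigma : nat -> M),
  position p -> (forall i, free i phi -> iso p (rho i) (sigma i)) ->
  (sat rho phi <-> sat_class hull sigma phi).
Proof.
  assert (Cons : forall q (p p' : M) rho sigma u x, (forall a b, related p a b -> related p' a b) ->
    (forall i, free i (Ex q) -> iso p (rho i) (sigma i)) -> iso p' u x ->
    forall i, free i q -> iso p' (scons u rho i) (scons x sigma i)).
  { intros q p p' rho sigma u x E H Hux [|i] Hi; simpl; [exact Hux|].
    eapply iso_mono; [exact E|]; apply H, Hi. }
  induction phi as [i j|i j|i|q IH|q IHq s IHs|q IHq s IHs|q IHq s IHs|q IH|q IH];
    intros p rho sigma Pos H; simpl in *.
  - destruct Pos as (X & Y & _ & _ & _ & _ & _ & _ & _ & _ & _ & _ & _ & F & I).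
    pose proof (H i (or_introl eq_refl)) as Hi.
    pose proof (H j (or_intror eq_refl)) as Hj; split; intro E.
    + rewrite E in Hi; eapply iso_functional; eauto.
    + rewrite E in Hi; eapply iso_injective; eauto.
  - destruct Pos as (X & Y & _ & _ & _ & _ & _ & _ & _ & _ & _ & _ & _ & F & I).
    pose proof (H i (or_introl eq_refl)) as Hi.
    pose proof (H j (or_intror eq_refl)) as Hj.
    apply iso_unfold in Hj as [(Uj & Uj' & _)|(_ & _ & K1 & K2)].
    + split; intro K; [destruct (zfu_urelements hM Uj K)|destruct (zfu_urelements hM Uj' K)].
    + split; intro K.
      * destruct (K1 _ K) as (d & Hd & Kd).
        rewrite (iso_functional hM F Hi Kd); exact Hd.
      * destruct (K2 _ K) as (c & Hc & Kc).
        rewrite (iso_injective hM I Hi Kc); exact Hc.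
  - pose proof (H i eq_refl) as Hi.
    apply iso_unfold in Hi as [(Ui & Ui' & _)|(Ni & Ni' & _)]; [tauto|].
    unfold is_set in *; tauto.
  - rewrite (IH p rho sigma); auto; tauto.
  - rewrite (IHq p rho sigma), (IHs p rho sigma); auto; tauto.
  - rewrite (IHq p rho sigma), (IHs p rho sigma); auto; tauto.
  - rewrite (IHq p rho sigma), (IHs p rho sigma); auto; tauto.
  - split.
    + intros K x Hx; destruct (back Pos Hx) as (p' & u & Pos' & E & Hux).
      apply (IH p' (scons u rho) (scons x sigma)); eauto.
    + intros K u; destruct (forth u Pos) as (p' & x & Pos' & E & Hux & Hx).
      apply (IH p' (scons u rho) (scons x sigma)); eauto.
  - split.
    + intros (u & K); destruct (forth u Pos) as (p' & x & Pos' & E & Hux & Hx).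
      exists x; split; [exact Hx|].
      apply (IH p' (scons u rho) (scons x sigma)); eauto.
    + intros (x & Hx & K); destruct (back Pos Hx) as (p' & u & Pos' & E & Hux).
      exists u; apply (IH p' (scons u rho) (scons x sigma)); eauto.
Qed.

Lemma common_room n (sigma : nat -> M) (F : nat -> Prop) :
  (forall i, i < n -> F i -> hull (sigma i)) ->
  exists T, room T /\ forall i, i < n -> F i ->
    supported (fun u => (u ∈ A \/ u ∈ B) /\ ~ u ∈ T) (sigma i).
Proof.
  induction n as [|n IH]; intro H.
  - exists B; split; [apply room_base|intros i Hi; lia].
  - destruct IH as (T & HT & K); [auto|].
    assert (Split : forall i, i < S n -> i < n \/ i = n) by lia.
    destruct (classic (F n)) as [Fn|Nn].
    + destruct (H n) as (T' & HT' & K'); [lia|exact Fn|].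
      destruct (room_compare HT HT') as [I|I]; [exists T|exists T']; split; auto;
        intros i Hi Fi; destruct (Split i Hi) as [Hi'| ->]; auto;
        (eapply supported_weaken; [|eauto]); simpl; intros a [Ha Na]; auto.
    + exists T; split; [exact HT|]; intros i Hi Fi.
      destruct (Split i Hi) as [Hi'| ->]; [auto|contradiction].
Qed.

(** Only finitely many values matter, so a single room [T] is avoided by all of them, and the
    identity on [A ∪ B] without [T] is a position that fixes them. *)
Lemma sat_hull (phi : form) (sigma : nat -> M) :
  (forall i, free i phi -> hull (sigma i)) -> (sat sigma phi <-> sat_class hull sigma phi).
Proof.
  intro H; destruct (@common_room (bound phi) sigma (fun i => free i phi))
    as (T & HT & K); [auto|].
  destruct (binary_union hM (proj1 hA) (proj1 hB)) as (U & hU & HU).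
  destruct (difference hM T hU) as (Y & hY & HY).
  destruct (class_bijection hM (P := fun a b => a = b) (X := Y) (Y := Y))
    as (p & Bp & Hp); [def|exact hY|exact hY|eauto|eauto|congruence|congruence|].
  apply hull_elementary with p.
  - exists Y, Y, T; assert (SY : set_of_urelements Y).
    { split; [exact hY|]; intros a Ha; apply HY in Ha as [Ha _].
      apply HU in Ha as [Ha|Ha]; [apply hA, Ha|apply hB, Ha]. }
    assert (AY : subset A Y).
    { intros z Hz; apply HY; rewrite HU; split; [auto|]; intro K'.
      apply (BA (z := z)); split; [apply (room_subset HT), K'|exact Hz]. }
    refine (conj SY (conj SY (conj AY (conj AY (conj _ (conj HT (conj _
      (bijection_bij Bp)))))))).
    + intros z Hz; apply HY in Hz as [Hz _]; apply HU, Hz.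
    + intros z [Hz Hz']; apply HY in Hz; tauto.
  - intros i Hi; apply (iso_refl hM) with Y.
    + intros a Ha; apply Hp; auto.
    + eapply supported_weaken; [|apply K; [apply free_bound, Hi|exact Hi]].
      simpl; intros a; rewrite HY, HU; tauto.
Qed.

Lemma Def_hull : Def (fun e => hull (e 0)).
Proof. unfold hull, supported; def. Qed.

Lemma hull_reflection (phi : form) (x : M) :
  supported (fun u => u ∈ A) x -> exists t, transitive_set t /\ subset x t /\
  forall rho, (forall i, free i phi -> rho i ∈ t) -> (sat rho phi <-> sat_rel t rho phi).
Proof.
  intro Hx; destruct (binary_union hM (proj1 hA) (proj1 hB)) as (U & hU & HU).
  assert (SU : set_of_urelements U).
  { split; [exact hU|]; intros a Ha; apply HU in Ha as [Ha|Ha]; [apply hA|apply hB]; auto. }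
  assert (Wx : hull x).
  (* The largest room [B] will do, since [A] is disjoint from it. *)
  { exists B; split; [apply room_base|]; eapply supported_weaken; [|exact Hx].
    simpl; intros a Ha; split; [auto|]; intro K; apply (BA (z := a)); auto. }
  assert (Wtr : forall y z, hull y -> z ∈ y -> hull z).
  { intros y z (T & HT & Hy) Hz; exists T; split; [exact HT|].
    eapply supported_mem; eauto. }
  destruct (@class_reflection _ hM U SU hull Def_hull) with (p := phi) (x := x) (w0 := x)
    as (t & Ht & xt & tW & R); auto.
  - intros y (T & _ & Hy); eapply supported_weaken; [|exact Hy].
    simpl; intros a [Ha _]; apply HU, Ha.
  - eapply supported_weaken; [|exact Hx]; simpl; intros a Ha; apply HU; auto.
  - exists t; split; [exact Ht|split].
    + intros y Hy; apply xt; [exact Hy|]; eapply Wtr; eauto.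
    + intros rho Hrho; rewrite <- sat_class_mem, <- R by exact Hrho.
      apply sat_hull; auto.
Qed.

End Elementarity.

Lemma tail_doubles (M : structure) (hM : ZFUR M) (A B : M) :
  set_of_urelements A -> set_of_urelements B ->
  (forall C X, set_of_urelements C -> disjoint C A -> set_of_urelements X ->
    copyable C X) ->
  disjoint B A -> (forall C : M, set_of_urelements C -> disjoint C A -> injects C B) ->
  exists f0 f1, inj f0 B B /\ inj f1 B B /\
    forall a a' b, related f0 a b -> ~ related f1 a' b.
Proof.
  intros hA hB copies BA tail.
  destruct (binary_union hM (proj1 hA) (proj1 hB)) as (U & hU & HU).
  assert (SU : set_of_urelements U).
  { split; [exact hU|]; intros a Ha; apply HU in Ha as [Ha|Ha]; [apply hA|apply hB]; auto. }
  destruct (copies B U hB BA SU) as (D & HD & DU & I).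
  destruct (binary_union hM (proj1 hB) (proj1 HD)) as (V & hV & HV).
  assert (SV : set_of_urelements V).
  { split; [exact hV|]; intros a Ha; apply HV in Ha as [Ha|Ha]; [apply hB|apply HD]; auto. }
  assert (J : injects V B).
  { apply tail; [exact SV|]; intros z [Hz Hz']; apply HV in Hz as [Hz|Hz].
    - apply (BA z); auto.
    - apply (DU z); split; [exact Hz|apply HU; auto]. }
  destruct (injects_inj I) as (q & Hq & Q2 & Q3 & Q4).
  destruct (injects_inj J) as (g & Hg & G2 & G3 & G4).
  (* [f0] is [g] on [B], and [f1] is [g] after the copying map [q] into [D]; their images are
     disjoint because [g] is injective and [D] misses [B]. *)
  destruct (class_injection hM (P := fun a b => related g a b) (X := B) (Y := B))
    as (f0 & H0 & E0); [def|apply hB|apply hB|..]; eauto.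
  { intros a Ha; destruct (G2 a) as (b & Hb); [apply HV; auto|].
    exists b; split; [apply (Hg _ _ Hb)|exact Hb]. }
  destruct (class_injection hM (P := fun a b => exists d, related q a d /\ related g d b)
    (X := B) (Y := B)) as (f1 & H1 & E1); [def|apply hB|apply hB|..].
  { intros a Ha; destruct (Q2 a Ha) as (d & Hd).
    destruct (G2 d) as (b & Hb); [apply HV; right; apply (Hq _ _ Hd)|].
    exists b; split; [apply (Hg _ _ Hb)|eauto]. }
  { intros a b b' _ (d & Hd & Hb) (d' & Hd' & Hb').
    rewrite (Q3 _ _ _ Hd Hd') in Hb; eauto. }
  { intros a a' b _ _ (d & Hd & Hb) (d' & Hd' & Hb').
    rewrite (G4 _ _ _ Hb Hb') in Hd; eauto. }
  exists f0, f1; split; [exact H0|split; [exact H1|]].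
  intros a a' b Ha Ha'; apply E0 in Ha as (Ha & _ & Hb).
  apply E1 in Ha' as (_ & _ & d & Hd & Hb').
  rewrite (G4 _ _ _ Hb Hb') in Ha; apply (DU d); split; [apply (Hq _ _ Hd)|].
  apply HU; auto.
Qed.

Unset Implicit Arguments.

Theorem theorem2p22 (M : structure) (hM : ZFUR M) :
  (TailPlus M -> forall phi : form, RP M phi) /\
  (PlenitudePlus M -> Duplication M).
Proof.
  split; [|apply (plenitude_duplication hM)].
  intros TP phi x hx.
  destruct (tail_plus_copies hM TP) as (A0 & SA0 & Copies).
  destruct (transitive_closure hM x) as (s & Hs & Hxs).
  destruct (@separation _ hM (fun z => ur z) s) as (K & hK & HK); [def|apply Hs|].
  destruct (binary_union hM (proj1 SA0) hK) as (A & hA & HA).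
  assert (SA : set_of_urelements A).
  { split; [exact hA|]; intros a Ha; apply HA in Ha as [Ha|Ha]; [apply SA0, Ha|].
    apply HK, Ha. }
  assert (CopiesA : forall C X, set_of_urelements C -> disjoint C A ->
    set_of_urelements X -> copyable C X).
  { intros C X HC CA HX; apply Copies; auto.
    intros z [Hz Hz']; apply (CA z); split; [exact Hz|apply HA; auto]. }
  (* This tail belongs to the enlarged [A]; the one used in [tail_plus_copies] belongs to the empty
     set. *)
  destruct (TP A SA) as (B & (SB & BA & tail) & _).
  destruct (tail_doubles hM SA SB CopiesA BA tail) as (f0 & f1 & H0 & H1 & H01).
  apply (hull_reflection hM SA SB BA CopiesA tail H0 H1 H01).
  exists s; split; [exact Hs|split; [exact Hxs|]].
  intros u Hu Uu; apply HA; right; apply HK; auto.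
Qed.
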